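(* Let $\kappa$ be an algebraically closed field and let $d,m,r$ be positive integers with $m\leq r\leq\binom{d+m}{m}$. Suppose that at least one of the following holds: (1) $d=1$; (2) $m=1$; (3) $m=2$; (4) $r=m$; (5) $\binom{m+d}{d}-d\leq r\leq\binom{m+d}{d}$. Then $$u_r(d,m)=H'_{r-(m-1)}(d,m).$$
   Context: Let $S_d(m,\kappa)$ be the space of homogeneous polynomials of degree $d$ in $\kappa[x_0,\dots,x_m]$ (together with $0$). For $m\leq r\leq\binom{m+d}{d}$ define $$u_r(d,m):=\max\{|V(W)| : W\subseteq S_d(m,\kappa)\text{ a linear subspace},\ \dim(W)=r,\ \dim(V(W))=0\},$$ where $V(W)\subseteq\mathbb{P}^m(\kappa)$ is the common zero set of $W$ and $|V(W)|$ is its number of points (counted without multiplicity); here the condition $\dim(V(W))=0$ means that $V(W)$ is finite, the empty set being allowed. Let $\Omega'(d,m)$ be the set of tuples $(\alpha_1,\dots,\alpha_{m+1})\in\mathbb{Z}_{\geq 0}^{m+1}$ with $\sum_{i=1}^{m+1}\alpha_i=d$ and $d\notin\{\alpha_2,\dots,\alpha_m\}$. It has $\binom{m+d}{d}-(m-1)$ elements; order it lexicographically and let $\omega'_r(d,m)$ be its $r$-th largest element. If $\omega'_r(d,m)=(\alpha_1,\dots,\alpha_{m+1})$, define $$H'_r(d,m):=\alpha_1d^{m-1}+\alpha_2d^{m-2}+\dots+\alpha_m=\sum_{i=1}^m\alpha_i d^{m-i}.$$ *)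

(* Defs.v *)
From mathcomp Require Import all_boot all_order all_algebra finmap.
From mathcomp Require Import mpoly.

Set Implicit Arguments.
Unset Strict Implicit.
Unset Printing Implicit Defensive.

Import Order.TTheory GRing.Theory.

Local Open Scope ring_scope.

(* P^m(K): a point is a line through the origin of K^(m+1). *)
Notation proj_space K m := {L : {vspace 'rV[K]_m.+1} | \dim L == 1%N}.

(* S_d(m, K); 0 is homogeneous of every degree. *)
Notation hpoly K d m := (dhomog m.+1 K d).

Definition in_zero_locus (K : fieldType) (d m : nat)
    (W : {vspace hpoly K d m}) (P : proj_space K m) : Prop :=
  forall p : hpoly K d m, p \in W ->
  forall v : 'rV[K]_m.+1, v \in val P ->
  (p : {mpoly K[m.+1]}).@[fun i => v 0 i] = 0.

(* k is the number of points of V(W) for some linear system W of dimension r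
   with V(W) finite, possibly empty: over an algebraically closed field this
   finiteness is the condition dim V(W) = 0. *)
Definition finite_zero_count (K : fieldType) (d m r k : nat) : Prop :=
  exists (W : {vspace hpoly K d m}) (S : {fset proj_space K m}),
    [/\ \dim W = r, (forall P, P \in S <-> in_zero_locus W P)
      & #|` S| = k].

(* n is the maximum of A; in particular the maximum is attained. *)
Definition is_max (A : nat -> Prop) (n : nat) : Prop :=
  A n /\ (forall k, A k -> (k <= n)%N).

(* "u_r(d, m) = n" *)
Definition u_is (K : fieldType) (r d m n : nat) : Prop :=
  is_max (finite_zero_count K d m r) n.

(* The entry alpha_i of the text is [tnth a] at index i - 1. Bounding entries
   by d loses nothing, since they are nonnegative with sum d. *)
Definition Omega' (d m : nat) : {set m.+1.-tuple 'I_d.+1} :=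
  [set a : m.+1.-tuple 'I_d.+1 |
    (\sum_(i < m.+1) (tnth a i : nat) == d)%N &
    [forall i : 'I_m.+1, (0 < i < m)%N ==> (tnth a i != d :> nat)]].

(* r-th largest element (r >= 1); the default value of [nth] is not used for
   r <= #|Omega' d m|. *)
Definition omega' (r d m : nat) : m.+1.-tuple 'I_d.+1 :=
  nth [tuple of nseq m.+1 ord0]
    (sort (fun a b : m.+1.-tuplelexi 'I_d.+1 => (b <= a)%O)
       (enum (Omega' d m)))
    r.-1.

Definition H' (r d m : nat) : nat :=
  (\sum_(i < m) tnth (omega' r d m) (widen_ord (leqnSn m) i)
      * d ^ (m - i.+1))%N.

(* Main.v *)
(** Lower bound. Let a_0, ..., a_d be distinct scalars. The forms
    f_b = prod_k prod_(j < b_k) (X_k - a_j X_m) * X_m^(b_m), for exponents b of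
    degree d, are triangular with respect to evaluation at the points
    (a_(g_1) : ... : a_(g_m) : 1). The forms f_b with b >= alpha in Omega',
    together with those of the exponents d e_2, ..., d e_m excluded from Omega',
    vanish exactly at the grid points whose digit vector g in [0, d)^m is
    lexicographically smaller than alpha. Reading g in base d, there are
    H'(alpha) of them.

    Upper bound. Let c be the codimension of W in the forms of degree d; it is
    the number of b in Omega' below alpha, so c <= H'(alpha) by reading in base d.
    - At most d + 1 points impose independent conditions on forms of degree d,
      so |V(W)| <= c when c <= d; this covers d = 1 and m = 1 as well.
    - If r = m, restrict W to a hyperplane avoiding V(W). What remains are m
      forms of degree d in m variables without common zero. These form a
      regular sequence (induction on m, through the Nullstellensatz and the
      permutability of homogeneous regular sequences), whose quotient has
      dimension at most d^m, and this dimension bounds the number of points.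
    - If m = 2, let h be the first difference of the Hilbert function of V(W).
      It is the Hilbert function of a quotient of the binary forms on a line
      avoiding V(W), and it decreases strictly from degree d - 1 on because the
      restriction of W has no common zero. The bound follows numerically. *)

From HB Require Import structures.
Require Import Defs.
From mathcomp Require Import all_boot all_order all_algebra.
From mathcomp Require Import finmap mpoly zify ring.
From Stdlib Require Import Classical ClassicalEpsilon.
From Stdlib Require Import FunctionalExtensionality PropExtensionality.

Set Implicit Arguments.
Unset Strict Implicit.
Unset Printing Implicit Defensive.

Import Order.TTheory GRing.Theory.
Local Open Scope ring_scope.

#[local] Hint Resolve dhomog_is_dhomog : core.

(** * Graded pieces of homogeneous ideals *)

Section PropSubspace.
Variables (K : fieldType) (V : vectType K).

Definition lin_closed (P : V -> Prop) : Prop :=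
  P 0 /\ forall a u v, P u -> P v -> P (a *: u + v).

(** As long as [P] holds of a vector outside the subspace found so far, that vector is added; the
    codimension [k] bounds the number of additions. *)
Lemma lin_closed_vspace (P : V -> Prop) :
  lin_closed P -> exists U : {vspace V}, forall v, v \in U <-> P v.
Proof.
move=> [P0 PD].
suff H k (U : {vspace V}) : (\dim {:V} - \dim U <= k)%N ->
    (forall v, v \in U -> P v) -> exists U : {vspace V}, forall v, v \in U <-> P v.
  by apply: (H _ 0%VS (leqnn _)) => v; rewrite memv0 => /eqP->.
elim: k U => [|k IHk] U dU sUP.
  have /eqP eU : U == fullv by rewrite -(dimv_leqif_eq (subvf U)) eqn_leq dimvS ?subvf; lia.
  by exists U => v; split=> [/sUP//|_]; rewrite eU memvf.
case: (classic (exists2 v, P v & v \notin U)) => [[v Pv vU]|noV]; last first.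
  exists U => v; split=> [/sUP//|Pv]; apply: NNPP => /negP vU; apply: noV.
  by exists v.
apply: (IHk (<[v]> + U)%VS) => [|w /memv_addP[x /vlineP[a ->]] [u /sUP Pu ->]];
  last exact: PD.
suff : (\dim U < \dim (<[v]> + U))%N by lia.
rewrite (ltn_leqif (dimv_leqif_sup (addvSr _ _))); apply: contra vU => /subvP; apply.
by apply: subvP (addvSl _ _) _ _; rewrite memv_line.
Qed.

(** The value is unspecified unless [P] is closed under linear combinations. *)
Definition vspace_of (P : V -> Prop) : {vspace V} :=
  epsilon (inhabits 0%VS) (fun U : {vspace V} => forall v, v \in U <-> P v).

Lemma vspace_ofP (P : V -> Prop) : lin_closed P -> forall v, v \in vspace_of P <-> P v.
Proof. by move=> /lin_closed_vspace sP; exact: (epsilon_spec (inhabits 0%VS) _ sP). Qed.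

End PropSubspace.

Lemma dim_lpreim (K : fieldType) (U V : vectType K) (f : 'Hom(U, V)) (W : {vspace V}) :
  \dim (f @^-1: W) = (\dim (lker f) + \dim (W :&: limg f))%N.
Proof.
rewrite -(limg_ker_dim f (f @^-1: W)); congr (_ + _)%N.
  congr (\dim _); apply/capv_idPr.
  by rewrite -lpreim0 lpreimS // sub0v.
by rewrite -lpreim_cap_limg lpreimK // capvSr.
Qed.

Section Homogeneous.
Variables (n : nat) (K : fieldType).
Implicit Types (p q f : {mpoly K[n]}).

(** The component of [p] of degree [i] contributes to [p * f] only in degree [i + d], so only
    [i = k - d] survives. The test on [d <= k] is there because the subtraction is truncated. *)
Lemma pihomog_mulr d f k p : f \is d.-homog ->
  pihomog mdeg k (p * f) = if (d <= k)%N then pihomog mdeg (k - d) p * f else 0.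
Proof.
move=> fd; have E := @pihomog_partitionE n K mdeg _ p (leqnn _).
rewrite {1}E mulr_suml linear_sum /=.
have H (i : nat) : pihomog mdeg k (pihomog mdeg i p * f) =
    if i + d == k then pihomog mdeg i p * f else 0.
  have hM : pihomog mdeg i p * f \is (i + d).-homog by apply: dhomogM => //; apply: pihomogP.
  case: eqP => [<-|/eqP ne]; first by rewrite pihomog_dE.
  exact: pihomog_ne0 hM.
under eq_bigr => i _ do rewrite H.
rewrite -big_mkcond /=.
case: leqP => dk; last by rewrite big1 // => i /eqP; lia.
rewrite (eq_bigl (fun i : 'I__ => i == k - d :> nat)%N); last by move=> i /=; lia.
case: (ltnP (k - d) (mmeasure mdeg p)) => lt.
  by rewrite (big_pred1 (Ordinal lt)).
rewrite big1 => [|i /eqP ik]; last by have := ltn_ord i; lia.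
rewrite [X in pihomog mdeg (k - d) X]E linear_sum /= big1 ?mul0r // => i _.
by rewrite (pihomog_ne0 _ (pihomogP mdeg _ _)) //; have := ltn_ord i; lia.
Qed.

Definition hproj k p : dhomog n K k := DHomog (pihomogP mdeg k p).

Lemma hproj_is_linear k : linear (hproj k).
Proof. by move=> a p q; apply/val_inj; rewrite /= linearP. Qed.
HB.instance Definition _ k :=
  GRing.isLinear.Build K {mpoly K[n]} (dhomog n K k) _ (hproj k) (@hproj_is_linear k).

Lemma hprojE k p : p \is k.-homog -> val (hproj k p) = p.
Proof. exact: pihomog_dE. Qed.

(* Ideals are predicates; classical choice turns their graded pieces into
   subspaces, see [vspace_of]. *)
Record hom_ideal (I : {mpoly K[n]} -> Prop) : Prop := HomIdeal {
  ideal0 : I 0;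
  idealD : forall p q, I p -> I q -> I (p + q);
  idealM : forall p q, I q -> I (p * q);
  ideal_pihomog : forall d p, I p -> I (pihomog mdeg d p) }.

Lemma idealB I p q : hom_ideal I -> I p -> I q -> I (p - q).
Proof. by move=> hI Ip Iq; rewrite -[- q]mulN1r; apply: idealD => //; apply: idealM. Qed.

Lemma idealZ I a p : hom_ideal I -> I p -> I (a *: p).
Proof. by move=> hI Ip; rewrite -mul_mpolyC; apply: idealM. Qed.

Lemma ideal_sum I (J : Type) (r : seq J) (P : pred J) (F : J -> {mpoly K[n]}) :
  hom_ideal I -> (forall j, P j -> I (F j)) -> I (\sum_(j <- r | P j) F j).
Proof.
move=> hI IF; elim/big_ind: _ => //; first exact: ideal0.
by move=> *; apply: idealD.
Qed.

Lemma ideal_components I p : hom_ideal I -> (forall k, I (pihomog mdeg k p)) -> I p.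
Proof.
move=> hI Ip; rewrite (@pihomog_partitionE n K mdeg _ p (leqnn _)).
by apply: ideal_sum.
Qed.

(** This is the ideal [(I, f)]; [colon] below is the ideal quotient [(I : f)]. *)
Definition adjoin (I : {mpoly K[n]} -> Prop) f p :=
  exists i g, I i /\ p = i + g * f.

Definition colon (I : {mpoly K[n]} -> Prop) f p := I (p * f).

Lemma adjoin_ideal I d f : hom_ideal I -> f \is d.-homog -> hom_ideal (adjoin I f).
Proof.
move=> hI fd; split.
- by exists 0, 0; rewrite mul0r addr0; split=> //; apply: ideal0.
- move=> _ _ [i [g [Ii ->]]] [j [h [Ij ->]]]; exists (i + j), (g + h).
  by split; [apply: idealD | rewrite mulrDl addrACA].
- move=> p _ [i [g [Ii ->]]]; exists (p * i), (p * g).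
  by split; [apply: idealM | rewrite mulrDr mulrA].
- move=> k _ [i [g [Ii ->]]]; rewrite linearD /= (pihomog_mulr _ _ fd).
  case: leqP => _.
    exists (pihomog mdeg k i), (pihomog mdeg (k - d) g).
    by split=> //; apply: ideal_pihomog.
  by exists (pihomog mdeg k i), 0; rewrite mul0r; split=> //; apply: ideal_pihomog.
Qed.

Lemma colon_ideal I d f : hom_ideal I -> f \is d.-homog -> hom_ideal (colon I f).
Proof.
move=> hI fd; rewrite /colon; split.
- by rewrite mul0r; apply: ideal0.
- by move=> p q Ip Iq; rewrite mulrDl; apply: idealD.
- by move=> p q Iq; rewrite -mulrA; apply: idealM.
- move=> k p /(ideal_pihomog hI (k + d)); rewrite (pihomog_mulr _ _ fd) leq_addl.
  by rewrite addnK.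
Qed.

Lemma zero_is_ideal : hom_ideal (fun p => p = 0).
Proof.
split=> //; first by move=> p q -> ->; rewrite addr0.
  by move=> p q ->; rewrite mulr0.
by move=> d p ->; rewrite linear0.
Qed.

Lemma sub_adjoin I f p : I p -> adjoin I f p.
Proof. by move=> Ip; exists p, 0; rewrite mul0r addr0. Qed.

Lemma adjoin_gen I f : hom_ideal I -> adjoin I f f.
Proof. by move=> hI; exists 0, 1; rewrite mul1r add0r; split=> //; apply: ideal0. Qed.

Lemma sub_colon I f p : hom_ideal I -> I p -> colon I f p.
Proof. by move=> hI Ip; rewrite /colon mulrC; apply: idealM. Qed.

(** An equality of predicates, obtained by extensionality, so that generators can be permuted by
    rewriting. *)
Lemma adjoinC I f g : adjoin (adjoin I f) g = adjoin (adjoin I g) f.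
Proof.
suff H f' g' p : adjoin (adjoin I f') g' p -> adjoin (adjoin I g') f' p.
  by apply: functional_extensionality => p; apply: propositional_extensionality; split; apply: H.
move=> [_ [b [[i [a [Ii ->]]] ->]]]; exists (i + b * g'), a.
by split; [exists i, b | rewrite addrAC].
Qed.

End Homogeneous.

(** * Hilbert functions of quotients by homogeneous ideals *)

Section Hilbert.
Variables (n : nat) (K : fieldType).
Local Notation S := {mpoly K[n.+1]}.
Implicit Types (I J : S -> Prop) (f : S).

Definition piece I k : {vspace dhomog n.+1 K k} := vspace_of (fun p : dhomog n.+1 K k => I (val p)).

Lemma pieceP I k : hom_ideal I -> forall p : dhomog n.+1 K k, p \in piece I k <-> I (val p).
Proof.
move=> hI p; apply: (@vspace_ofP _ _ (fun p : dhomog n.+1 K k => I (val p))).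
split=> [|a u v Iu Iv]; first exact: ideal0.
by apply: idealD => //; apply: idealZ.
Qed.

(* The Hilbert function of the quotient by [I]. *)
Definition hilb I k : nat := (\dim {:dhomog n.+1 K k} - \dim (piece I k))%N.

Lemma hilbE I k : (hilb I k + \dim (piece I k) = \dim {:dhomog n.+1 K k})%N.
Proof. by rewrite subnK // dimvS // subvf. Qed.

Lemma dim_dhomog k : \dim {:dhomog n.+1 K k} = 'C(k + n, k).
Proof. by rewrite dimvf. Qed.

Lemma piece_sub I J k : hom_ideal I -> hom_ideal J ->
  (forall p, p \is k.-homog -> I p -> J p) -> (piece I k <= piece J k)%VS.
Proof. by move=> hI hJ IJ; apply/subvP => p /(pieceP hI) Ip; apply/(pieceP hJ); exact: IJ. Qed.

Lemma hilb_anti I J k : hom_ideal I -> hom_ideal J ->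
  (forall p, p \is k.-homog -> I p -> J p) -> (hilb J k <= hilb I k)%N.
Proof. by move=> hI hJ IJ; apply/leq_sub2l/dimvS/piece_sub. Qed.

Lemma hilb_full I k : hom_ideal I -> (forall p, p \is k.-homog -> I p) -> hilb I k = 0%N.
Proof.
move=> hI IS; rewrite /hilb (_ : piece I k = fullv) ?subnn //.
by apply/vspaceP => x; rewrite memvf; apply/(pieceP hI)/IS.
Qed.

(** The piece of [I] is contained in the piece of [J] and has at least its dimension, so the two
    coincide. *)
Lemma hilb_le_sub I J k : hom_ideal I -> hom_ideal J ->
  (forall p, p \is k.-homog -> I p -> J p) -> (hilb I k <= hilb J k)%N ->
  forall p, p \is k.-homog -> J p -> I p.
Proof.
move=> hI hJ IJ le p pk Jp; have sIJ := piece_sub hI hJ IJ.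
have : (piece J k <= piece I k)%VS.
  by rewrite -(geq_leqif (dimv_leqif_sup sIJ)); have := hilbE I k; have := hilbE J k; lia.
move/subvP/(_ (hproj k p)) => H; have := H.
rewrite (_ : hproj k p \in piece J k); last by apply/(pieceP hJ); rewrite hprojE.
by move=> /(_ isT)/(pieceP hI); rewrite hprojE.
Qed.

Definition mulH f k l (x : dhomog n.+1 K k) : dhomog n.+1 K l := hproj l (val x * f).

Lemma mulH_is_linear f k l : linear (@mulH f k l).
Proof. by move=> a x y; rewrite /mulH linearP mulrDl -scalerAl linearP. Qed.
HB.instance Definition _ f k l :=
  GRing.isLinear.Build K (dhomog n.+1 K k) (dhomog n.+1 K l) _ (@mulH f k l)
    (@mulH_is_linear f k l).

Lemma mulHE f d k (x : dhomog n.+1 K k) : f \is d.-homog ->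
  val (mulH f (k + d) x) = val x * f.
Proof. by move=> fd; rewrite hprojE //; apply: dhomogM. Qed.

(** Multiplication by [f] gives the exact sequence from [S/(I : f)], shifted by [d], through [S/I]
    to [S/(I, f)]. In degree [k + d] the piece of [(I, f)] is the piece of [I] plus the image of the
    multiplication, and the piece of [(I : f)] is a preimage under it. *)
Lemma hilb_colon I d f k : hom_ideal I -> f \is d.-homog ->
  (hilb (adjoin I f) (k + d) + hilb (colon I f) k = hilb I (k + d))%N.
Proof.
move=> hI fd; pose g : 'Hom(dhomog n.+1 K k, dhomog n.+1 K (k + d)) := linfun (mulH f (k + d)).
have gE x : val (g x) = val x * f by rewrite lfunE (mulHE _ fd).
have hA := adjoin_ideal hI fd; have hC := colon_ideal hI fd.
have eA : piece (adjoin I f) (k + d) = (piece I (k + d) + limg g)%VS.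
  apply/vspaceP => x; apply/idP/idP.
    move/(pieceP hA) => [i [h [Ii e]]]; apply/memv_addP.
    exists (hproj (k + d) i); first by apply/(pieceP hI); apply: ideal_pihomog.
    exists (g (hproj k h)); first by rewrite memv_img ?memvf.
    apply/val_inj; rewrite -[LHS](pihomog_dE (dhomog_is_dhomog x)) /= gE /= e linearD /=.
    by rewrite (pihomog_mulr _ _ fd) leq_addl addnK.
  move/memv_addP => [u /(pieceP hI) Iu [_ /memv_imgP[v _ ->] ->]]; apply/(pieceP hA).
  by exists (val u), (val v); split=> //; rewrite linearD /= gE.
have eC : piece (colon I f) k = (g @^-1: piece I (k + d))%VS.
  apply/vspaceP => x; rewrite -memv_preim; apply/idP/idP.
    by move/(pieceP hC) => Cx; apply/(pieceP hI); rewrite gE.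
  by move/(pieceP hI); rewrite gE => Cx; apply/(pieceP hC).
have := hilbE (adjoin I f) (k + d); have := hilbE (colon I f) k; have := hilbE I (k + d).
have := dimv_sum_cap (piece I (k + d)) (limg g); have := limg_ker_dim g fullv.
rewrite capfv eA eC dim_lpreim.
move: (\dim (lker g)) (\dim (limg g)) (\dim (piece I (k + d) + limg g)) => r1 r2 r3.
move: (\dim (piece I (k + d) :&: limg g)) (\dim (piece I (k + d))) => r4 r5.
by move: (hilb _ _) (hilb _ _) (hilb _ _) (\dim _) (\dim _) => x y z u v; lia.
Qed.

End Hilbert.

(** * Degree-preserving substitutions *)

Section GradedMaps.
Variables (K : fieldType).

Lemma dhomog_prodr n (J : Type) (r : seq J) (P : pred J) (F : J -> {mpoly K[n]}) (d : J -> nat) :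
  (forall j, P j -> F j \is (d j).-homog) ->
  \prod_(j <- r | P j) F j \is (\sum_(j <- r | P j) d j)%N.-homog.
Proof.
move=> H; elim/big_rec2: _ => [|j x y Pj Hy]; first exact: dhomog1.
by apply: dhomogM => //; apply: H.
Qed.

Lemma dhomog_var n (i : 'I_n) : ('X_i : {mpoly K[n]}) \is 1.-homog.
Proof. by rewrite dhomogX /= mdeg1. Qed.

Lemma comp_mpoly_dhomog n m (lq : n.-tuple {mpoly K[m]}) k p :
  (forall i, tnth lq i \is 1.-homog) -> p \is k.-homog -> p \mPo lq \is k.-homog.
Proof.
move=> hl hp; rewrite comp_mpolyEX big_seq; apply: rpred_sum => u up; apply: dhomogZ.
rewrite comp_mpolyX -(dhomog_mf hp up) /= mdegE; apply: dhomog_prodr => i _.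
by have := dhomogMn (u i) (hl i); rewrite mul1n.
Qed.

Lemma pihomog_graded n m (phi : {additive {mpoly K[n]} -> {mpoly K[m]}}) :
  (forall k p, p \is k.-homog -> phi p \is k.-homog) ->
  forall k p, pihomog mdeg k (phi p) = phi (pihomog mdeg k p).
Proof.
move=> H k p; rewrite {1}(@pihomog_partitionE n K mdeg _ p (leqnn _)).
rewrite (raddf_sum phi) (linear_sum (pihomog mdeg k)) /=.
have E (i : nat) : pihomog mdeg k (phi (pihomog mdeg i p)) =
    if i == k then phi (pihomog mdeg k p) else 0.
  have hi := H i _ (pihomogP mdeg i p).
  case: eqP => [<-|/eqP ne]; first by rewrite pihomog_dE.
  exact: pihomog_ne0 hi.
under eq_bigr => i _ do rewrite E.
rewrite -big_mkcond /=; case: (ltnP k (mmeasure mdeg p)) => lt.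
  by rewrite (big_pred1 (Ordinal lt)).
rewrite big1 => [|i /eqP ik]; last by have := ltn_ord i; lia.
rewrite [X in pihomog mdeg k X](@pihomog_partitionE n K mdeg _ p (leqnn _)) linear_sum /=.
rewrite big1 ?raddf0 // => i _.
by rewrite (pihomog_ne0 _ (pihomogP mdeg _ _)) //; have := ltn_ord i; lia.
Qed.

Lemma mdeg_mnmwiden n (u : 'X_{1..n}) : mdeg (mnmwiden u) = mdeg u.
Proof.
rewrite !mdegE big_ord_recr /= mnmwiden_ordmax addn0.
by apply: eq_bigr => i _; rewrite mnmwiden_widen.
Qed.

Lemma mwiden_dhomog n k (p : {mpoly K[n]}) : p \is k.-homog -> mwiden p \is k.-homog.
Proof.
move=> hp; rewrite [p]mpolyE raddf_sum big_seq; apply: rpred_sum => u up /=.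
by rewrite mwidenZ mwidenX; apply: dhomogZ; rewrite dhomogX /= mdeg_mnmwiden (dhomog_mf hp up).
Qed.

Lemma mpoly_ringind m (P : {mpoly K[m]} -> Prop) :
  (forall a, P a%:MP) -> (forall i, P 'X_i) -> (forall p q, P p -> P q -> P (p + q)) ->
  (forall p q, P p -> P q -> P (p * q)) -> forall p, P p.
Proof.
move=> PC PX PD PM p.
have P0 : P 0 by rewrite -mpolyC0; apply: PC.
rewrite [p]mpolyE; apply: (big_ind P) => // u _; rewrite -mul_mpolyC; apply: (PM) => //.
rewrite mpolyXE_id; apply: (big_ind P) => [|//|i _]; first by rewrite -mpolyC1; apply: PC.
elim: (u i) => [|k IHk]; first by rewrite expr0 -mpolyC1; apply: PC.
by rewrite exprS; apply: PM.
Qed.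

Lemma mwiden_var n (i : 'I_n) : mwiden ('X_i : {mpoly K[n]}) = 'X_(widen_ord (leqnSn n) i).
Proof. by rewrite mwidenX mnmwiden1. Qed.

Lemma mwiden_eval n (p : {mpoly K[n]}) (v : 'I_n.+1 -> K) :
  (mwiden p).@[v] = p.@[fun i => v (widen_ord (leqnSn n) i)].
Proof.
move: p; apply: mpoly_ringind => [a|i|p q IHp IHq|p q IHp IHq].
- by rewrite mwidenC !mevalC.
- by rewrite mwiden_var !mevalXU.
- by rewrite !rmorphD /= IHp IHq.
- by rewrite !rmorphM /= IHp IHq.
Qed.

End GradedMaps.

Section Extend.
Variables (n : nat) (A : Type).
Implicit Types (a : 'I_n -> A) (b : A).

Definition extend a b (i : 'I_n.+1) : A :=
  if unlift ord_max i is Some j then a j else b.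

Lemma lift_max (j : 'I_n) : lift ord_max j = widen_ord (leqnSn n) j.
Proof. by apply/val_inj; rewrite /= /bump leqNgt ltn_ord. Qed.

Lemma extend_widen a b i : extend a b (widen_ord (leqnSn n) i) = a i.
Proof. by rewrite /extend -lift_max liftK. Qed.

Lemma extend_max a b : extend a b ord_max = b.
Proof. by rewrite /extend unlift_none. Qed.

End Extend.

(** * Restriction to a hyperplane *)

Section Restriction.
Variables (n : nat) (K : fieldType) (c : 'I_n.+1 -> K).
Local Notation S := {mpoly K[n.+2]}.
Local Notation T := {mpoly K[n.+1]}.
Local Notation wid := (widen_ord (leqnSn n.+1)).

Definition lform (c : 'I_n.+1 -> K) : T := \sum_j c j *: 'X_j.
Definition restrict_tuple : n.+2.-tuple T := [tuple extend (fun j => 'X_j) (lform c) i | i < n.+2].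
(* Substitution of the linear form [lform c] for the last variable, that is,
   restriction to the zero set of [hyperplane]. *)
Definition restrict (p : S) : T := p \mPo restrict_tuple.

HB.instance Definition _ := GRing.RMorphism.copy restrict (comp_mpoly restrict_tuple).
HB.instance Definition _ := GRing.Linear.copy restrict (comp_mpoly restrict_tuple).

(** Hyperplanes are normalized to be solved for the last variable: restriction is then a
    substitution, with section [mwiden]. *)
Definition hyperplane : S := 'X_ord_max - mwiden (lform c).

Lemma lform_dhomog : lform c \is 1.-homog.
Proof. by apply: rpred_sum => i _; apply: dhomogZ; apply: dhomog_var. Qed.

Lemma hyperplane_dhomog : hyperplane \is 1.-homog.
Proof. by apply: rpredB; [apply: dhomog_var | apply: mwiden_dhomog; apply: lform_dhomog]. Qed.

Lemma restrict_dhomog k p : p \is k.-homog -> restrict p \is k.-homog.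
Proof.
apply: comp_mpoly_dhomog => i; rewrite tnth_mktuple /extend.
by case: unliftP => [j|] _; [apply: dhomog_var | apply: lform_dhomog].
Qed.

Lemma restrict_var i : restrict 'X_i = extend (fun j => 'X_j) (lform c) i.
Proof. by rewrite /restrict comp_mpolyXU -tnth_nth tnth_mktuple. Qed.

Lemma mwidenK q : restrict (mwiden q) = q.
Proof.
move: q; apply: mpoly_ringind => [a|i|p q IHp IHq|p q IHp IHq].
- by rewrite mwidenC /restrict comp_mpolyC.
- by rewrite mwiden_var restrict_var extend_widen.
- by rewrite !rmorphD /= IHp IHq.
- by rewrite !rmorphM /= IHp IHq.
Qed.

Lemma restrict_hyperplane : restrict hyperplane = 0.
Proof. by rewrite rmorphB /= restrict_var extend_max mwidenK subrr. Qed.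

(** This is division by [hyperplane], which is monic of degree one in the last variable; the
    quotient is built along sums and products. *)
Lemma restrict_decomp p : exists g, p = mwiden (restrict p) + g * hyperplane.
Proof.
move: p; apply: mpoly_ringind => [a|i|p q [g e] [h e']|p q [g e] [h e']].
- by exists 0; rewrite mul0r addr0 /restrict comp_mpolyC mwidenC.
- case: (unliftP ord_max i) => [j ->|->].
    by exists 0; rewrite mul0r addr0 restrict_var lift_max extend_widen mwiden_var.
  by exists 1; rewrite restrict_var extend_max mul1r addrC subrK.
- by exists (g + h); rewrite !rmorphD /= {1}e {1}e' mulrDl addrACA.
- exists (p * h + g * mwiden (restrict q)); rewrite !rmorphM /= {1}e' mulrDr {1}e.
  ring.
Qed.

Lemma lform_eval a : (lform c).@[a] = \sum_j c j * a j.
Proof. by rewrite raddf_sum; apply: eq_bigr => j _; rewrite /= mevalZ mevalXU. Qed.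

Lemma restrict_eval p a : (restrict p).@[a] = p.@[extend a (\sum_j c j * a j)].
Proof.
rewrite comp_mpoly_meval; apply: meval_eq => i; rewrite tnth_mktuple /extend.
case: unliftP => [j|] _; first by rewrite mevalXU.
exact: lform_eval.
Qed.

Lemma hyperplane_eval v : hyperplane.@[v] = v ord_max - \sum_j c j * v (wid j).
Proof.
by rewrite mevalB mevalXU mwiden_eval lform_eval.
Qed.

Lemma restrict_ideal J : hom_ideal J -> hom_ideal (fun p => J (restrict p)).
Proof.
move=> hJ; split.
- by rewrite rmorph0; apply: ideal0.
- by move=> p q Jp Jq; rewrite rmorphD; apply: idealD.
- by move=> p q Jq; rewrite rmorphM; apply: idealM.
- by move=> k p Jp; rewrite -(pihomog_graded restrict_dhomog); apply: ideal_pihomog.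
Qed.

Definition restrictH k (x : dhomog n.+2 K k) : dhomog n.+1 K k := hproj k (restrict (val x)).

Lemma restrictH_is_linear k : linear (@restrictH k).
Proof. by move=> a x y; rewrite /restrictH !linearP. Qed.
HB.instance Definition _ k :=
  GRing.isLinear.Build K (dhomog n.+2 K k) (dhomog n.+1 K k) _
    (@restrictH k) (@restrictH_is_linear k).

(** Restriction is onto in each degree, by the section [mwiden], so the quotient by a preimage is
    isomorphic to the quotient by [J]. *)
Lemma hilb_restrict J k : hom_ideal J -> hilb (fun p => J (restrict p)) k = hilb J k.
Proof.
move=> hJ; have hJ' := restrict_ideal hJ.
pose g : 'Hom(dhomog n.+2 K k, dhomog n.+1 K k) := linfun (@restrictH k).
have gE x : val (g x) = restrict (val x) by rewrite lfunE hprojE //; apply: restrict_dhomog.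
have gs : limg g = fullv.
  apply/vspaceP => y; rewrite memvf; apply/memv_imgP; exists (hproj k (mwiden (val y))).
    exact: memvf.
  by apply/val_inj; rewrite gE hprojE ?mwidenK //; apply: mwiden_dhomog.
have e : piece (fun p => J (restrict p)) k = (g @^-1: piece J k)%VS.
  apply/vspaceP => x; rewrite -memv_preim; apply/idP/idP.
    by move/(pieceP hJ') => Jx; apply/(pieceP hJ); rewrite gE.
  by move/(pieceP hJ); rewrite gE => Jx; apply/(pieceP hJ').
have := hilbE J k; have := hilbE (fun p => J (restrict p)) k; have := limg_ker_dim g fullv.
rewrite e dim_lpreim gs capvf capfv.
move: (hilb _ _) (hilb _ _) (\dim (lker g)) (\dim (piece J k)) => a b c' d.
by move: (\dim _) (\dim _) => x y; lia.
Qed.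

Lemma restrict_adjoin J f :
  (fun p => adjoin J (restrict f) (restrict p)) = adjoin (fun p => J (restrict p)) f.
Proof.
apply: functional_extensionality => p; apply: propositional_extensionality; split.
  move=> [i [g [Ji e]]]; exists (p - mwiden g * f), (mwiden g); rewrite subrK; split=> //.
  by rewrite rmorphB rmorphM /= mwidenK e addrK.
move=> [i [g [Ji ->]]]; exists (restrict i), (restrict g); split=> //.
by rewrite rmorphD rmorphM.
Qed.

Lemma restrict_ker : (fun p => restrict p = 0) = adjoin (fun p => p = 0) hyperplane.
Proof.
apply: functional_extensionality => p; apply: propositional_extensionality; split.
  have [g e] := restrict_decomp p; move=> p0; exists 0, g; split=> //.
  by rewrite {1}e p0 rmorph0.
by move=> [_ [g [-> ->]]]; rewrite rmorphD rmorphM /= restrict_hyperplane mulr0 rmorph0 addr0.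
Qed.

(** An ideal that contains the kernel of [restrict] is the preimage of its image; the image is
    described by pulling back along the section [mwiden]. *)
Lemma restrict_image I : hom_ideal I ->
  exists2 J, hom_ideal J & adjoin I hyperplane = (fun p => J (restrict p)).
Proof.
move=> hI; have hA := adjoin_ideal hI hyperplane_dhomog.
exists (fun q => adjoin I hyperplane (mwiden q)).
  split.
  - by rewrite rmorph0; apply: ideal0.
  - by move=> p q Jp Jq; rewrite rmorphD; apply: idealD.
  - by move=> p q Jq; rewrite rmorphM; apply: idealM.
  - move=> k p Jp; rewrite -(pihomog_graded (@mwiden_dhomog K n.+1)).
    exact: ideal_pihomog.
apply: functional_extensionality => p; apply: propositional_extensionality.
have [g e] := restrict_decomp p; split=> Ap.
  rewrite -[X in adjoin I hyperplane X](addrK (g * hyperplane)) -e; apply: idealB => //.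
  by apply: idealM => //; apply: adjoin_gen.
by rewrite e; apply: idealD => //; apply: idealM => //; apply: adjoin_gen.
Qed.

End Restriction.

(** * The projective Nullstellensatz *)

Section Radical.
Variables (n : nat) (K : fieldType) (I : {mpoly K[n]} -> Prop) (hI : hom_ideal I).

Definition radical p := exists N, I (p ^+ N).

Lemma radicalD p q : radical p -> radical q -> radical (p + q).
Proof.
move=> [N Ip] [M Iq]; exists (N + M)%N; rewrite exprDn; apply: ideal_sum => // i _.
rewrite -mulr_natl; apply: idealM => //; case: (leqP M i) => le.
  by rewrite -(subnK le) exprD mulrA; apply: idealM.
by rewrite (_ : (N + M - i = (M - i) + N)%N) ?exprD; [rewrite mulrAC; apply: idealM | lia].
Qed.

Lemma radicalM p q : radical q -> radical (p * q).
Proof. by move=> [N Iq]; exists N; rewrite exprMn; apply: idealM. Qed.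

Lemma sub_radical p : I p -> radical p.
Proof. by move=> Ip; exists 1; rewrite expr1. Qed.

Lemma radical_sum (J : Type) (r : seq J) (P : pred J) (F : J -> {mpoly K[n]}) :
  (forall j, P j -> radical (F j)) -> radical (\sum_(j <- r | P j) F j).
Proof.
by move=> IF; apply: (big_ind radical) => //; [exact: sub_radical (ideal0 hI) | exact: radicalD].
Qed.

End Radical.

Section Evaluation.
Variable (K : fieldType).

Lemma meval_scale n k (p : {mpoly K[n]}) t (v : 'I_n -> K) :
  p \is k.-homog -> p.@[fun i => t * v i] = t ^+ k * p.@[v].
Proof.
move=> hp; rewrite !mevalE mulr_sumr big_seq [RHS]big_seq; apply: eq_bigr => u up.
rewrite mulrCA; congr (_ * _); rewrite -(dhomog_mf hp up) /= mdegE.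
rewrite (big_morph (fun k => t ^+ k) (exprD t) (expr0 t)) -big_split /=.
by apply: eq_bigr => i _; rewrite exprMn.
Qed.

Lemma dhomog0_const n (p : {mpoly K[n]}) v : p \is 0.-homog -> p = (p.@[v])%:MP.
Proof.
move=> hp; suff {v}E : p = (p@_0)%:MP by rewrite {2}E mevalC -E.
apply/mpolyP => u; rewrite mcoeffC; case: (u =P 0%MM) => [->|ne]; first by rewrite mulr1.
by rewrite mulr0 (dhomog_nemf_coeff hp) //= mdeg_eq0; apply/eqP.
Qed.

Lemma dhomog_eval0 n k (p : {mpoly K[n]}) : (0 < k)%N -> p \is k.-homog -> p.@[fun _ => 0] = 0.
Proof.
move=> k0 hp; transitivity p.@[fun i => 0 * (fun _ => 0) i].
  by apply: meval_eq => i; rewrite mul0r.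
by rewrite (meval_scale _ _ hp) expr0n (gtn_eqF k0) mul0r.
Qed.

Lemma muni_mwiden n (q : {mpoly K[n]}) : muni (mwiden q) = q%:P.
Proof.
move: q; apply: mpoly_ringind => [a|i|p q IHp IHq|p q IHp IHq].
- by rewrite mwidenC muniC.
- rewrite mwiden_var muniE msuppX big_seq1 mcoeffX eqxx scale1r mnm1E.
  rewrite (_ : (_ == _) = false) ?expr0 ?alg_polyC; last first.
    by apply/negbTE; rewrite -lift_max eq_sym neq_lift.
  congr (_ %:P); congr 'X_[_]; apply/mnmP => j; rewrite mnmE !mnm1E.
  by congr (nat_of_bool _); rewrite -!lift_max (inj_eq lift_inj).
- by rewrite !rmorphD /= IHp IHq.
- by rewrite !rmorphM /= IHp IHq.
Qed.

Lemma muni_max n : muni ('X_ord_max : {mpoly K[n.+1]}) = 'X.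
Proof.
rewrite muniE msuppX big_seq1 mcoeffX eqxx scale1r mnm1E eqxx expr1.
rewrite (_ : [multinom _ | _ < _] = 0%MM) ?mpolyX0 ?scale1r //.
apply/mnmP => j; rewrite mnmE mnm1E mnm0E -lift_max.
by rewrite (negbTE (neq_lift _ _)).
Qed.

Definition unmuni n (P : {poly {mpoly K[n]}}) : {mpoly K[n.+1]} :=
  (map_poly (@mwiden n K) P).['X_ord_max].

Lemma unmuniM n (P Q : {poly {mpoly K[n]}}) : unmuni (P * Q) = unmuni P * unmuni Q.
Proof. by rewrite /unmuni rmorphM hornerM. Qed.

Lemma unmuniD n (P Q : {poly {mpoly K[n]}}) : unmuni (P + Q) = unmuni P + unmuni Q.
Proof. by rewrite /unmuni rmorphD hornerD. Qed.

Lemma unmuniC n (p : {mpoly K[n]}) : unmuni p%:P = mwiden p.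
Proof. by rewrite /unmuni map_polyC hornerC. Qed.

Lemma muniK n (p : {mpoly K[n.+1]}) : unmuni (muni p) = p.
Proof.
move: p; apply: mpoly_ringind => [a|i|p q IHp IHq|p q IHp IHq].
- by rewrite muniC unmuniC mwidenC.
- case: (unliftP ord_max i) => [j|] ->.
    by rewrite lift_max -mwiden_var muni_mwiden unmuniC.
  by rewrite muni_max /unmuni map_polyX hornerX.
- by rewrite muniD unmuniD; exact: (congr2 _ IHp IHq).
- by rewrite muniM unmuniM; exact: (congr2 _ IHp IHq).
Qed.

Lemma unmuni_eval n (P : {poly {mpoly K[n]}}) a b :
  (unmuni P).@[extend a b] = (map_poly (meval a) P).[b].
Proof.
elim/poly_ind: P => [|P p IHP]; first by rewrite /unmuni !rmorph0 !horner0 rmorph0.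
rewrite unmuniD unmuniM unmuniC /unmuni map_polyX hornerX -/(unmuni P).
rewrite mevalD mevalM IHP mevalXU extend_max mwiden_eval.
rewrite rmorphD rmorphM /= map_polyX map_polyC hornerD hornerM hornerX hornerC.
by congr (_ + _); apply: meval_eq => i; rewrite extend_widen.
Qed.

(** The subtraction [d - j] is truncated, whence the separate clause for [d < j]. *)
Lemma muni_coef_dhomog n d j (f : {mpoly K[n.+1]}) : f \is d.-homog ->
  (muni f)`_j \is (d - j).-homog /\ ((d < j)%N -> (muni f)`_j = 0).
Proof.
move=> fd.
have E : (muni f)`_j = \sum_(m <- msupp f | m \in msupp f)
   (j == m ord_max)%:R *: (f@_m *: 'X_[[multinom m (widen_ord (leqnSn n) i) | i < n]]).
  rewrite muniE coef_sum big_seq; apply: eq_bigr => m _; rewrite coefZ coefXn mulrC.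
  by rewrite mulr_natl scaler_nat.
have D m : m \in msupp f ->
    (mdeg [multinom m (widen_ord (leqnSn n) i) | i < n] + m ord_max = d)%N.
  move=> mf; rewrite -(dhomog_mf fd mf) /= !mdegE big_ord_recr /=; congr (_ + _)%N.
  by apply: eq_bigr => i _; rewrite mnmE.
rewrite E; split=> [|dj].
  apply: rpred_sum => m mf; case: eqP => [->|_]; last by rewrite scale0r rpred0.
  by rewrite scale1r; apply: dhomogZ; rewrite dhomogX -(D m mf) addnK.
rewrite big1 // => m /D Dm; case: eqP => [e|_]; last by rewrite scale0r.
by lia.
Qed.

End Evaluation.

(** If the leading coefficients survive under [h], the Sylvester matrices before and after have the
    same shape. *)
Lemma resultant_map (R R' : nzRingType) (h : {rmorphism R -> R'}) (p q : {poly R}) :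
  h (lead_coef p) != 0 -> h (lead_coef q) != 0 ->
  h (resultant p q) = resultant (map_poly h p) (map_poly h q).
Proof.
move=> p0 q0; rewrite /resultant /Sylvester_mx !size_map_poly_id0 // -det_map_mx.
congr (\det _); apply/matrixP => i j; rewrite !mxE.
by case: split => k; rewrite !mxE /= !rVpoly_delta !coefXnM; case: ifP; rewrite ?rmorph0 ?coef_map.
Qed.

Section Nullstellensatz.
Variable (K : closedFieldType).

(** By Euclidean division a nonzero element of [J] of least size divides all of [J]. It is not
    constant, since [1] is not in [J], so it has a root. *)
Lemma poly_common_root (J : {poly K} -> Prop) :
  (forall p q, J p -> J q -> J (p + q)) -> (forall p q, J q -> J (p * q)) ->
  (exists2 p, J p & p != 0) -> ~ J 1 -> exists b, forall p, J p -> p.[b] = 0.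
Proof.
move=> JD JM [p Jp p0] J1.
pose minimal h := [/\ J h, h != 0 & forall q, J q -> q != 0 -> (size h <= size q)%N].
have [h [Jh h0 hmin]] : exists h, minimal h.
  move: p Jp p0; suff H N (p : {poly K}) :
      (size p <= N)%N -> J p -> p != 0 -> exists h, minimal h.
    by move=> p; apply: H (leqnn _).
  elim: N p => [|N IHN] p; first by rewrite leqn0 size_poly_eq0 => /eqP-> _; rewrite eqxx.
  move=> sp Jp p0; case: (classic (exists q, [/\ J q, q != 0 & (size q < size p)%N])).
    by move=> [q [Jq q0 lt]]; apply: (IHN q) => //; lia.
  move=> no; exists p; split=> // q Jq q0; rewrite leqNgt; apply/negP => lt; apply: no.
  by exists q.
have hdvd q : J q -> h %| q.
  move=> Jq; rewrite /dvdp; have [//|r0] := eqVneq (q %% h) 0.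
  have Jr : J (q %% h).
    rewrite (_ : q %% h = q + - (q %/ h) * h); first by apply: JD => //; apply: JM.
    by rewrite {2}(divp_eq q h) mulNr addrAC subrr add0r.
  by have := hmin _ Jr r0; rewrite leqNgt ltn_modp h0.
have /closed_rootP[b hb] : size h != 1%N.
  apply/negP => /size_poly1P[c c0 hc]; apply: J1.
  by rewrite (_ : 1 = c^-1%:P * h); [apply: JM | rewrite hc -polyCM mulVf].
exists b => q /hdvd /dvdpP[s ->]; apply/rootP.
by rewrite rootM hb orbT.
Qed.

(** Some form of [I] does not vanish at [(0, ..., 0, 1)]. Evaluation there kills the coefficients
    that are forms of positive degree, so the coefficient of the top power of the last variable is a
    nonzero constant, and it can be scaled to [1]. *)
Lemma monic_form n (I : {mpoly K[n.+1]} -> Prop) : hom_ideal I ->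
  ~ (forall p, I p -> p.@[extend (fun _ : 'I_n => 0) 1] = 0) ->
  exists d f, [/\ I f, f \is d.-homog, muni f \is monic & size (muni f) = d.+1].
Proof.
move=> hI nz; have [f If fe] : exists2 f, I f & f.@[extend (fun _ : 'I_n => 0) 1] != 0.
  apply: NNPP => no; apply: nz => p Ip; apply/eqP/negP => /negP pe; apply: no.
  by exists p.
have [d fd] : exists d, (pihomog mdeg d f).@[extend (fun _ : 'I_n => 0) 1] != 0.
  apply: NNPP => no; case/negP: fe.
  rewrite (@pihomog_partitionE _ K mdeg _ f (leqnn _)) (raddf_sum (meval _)) big1 // => i _.
  by apply/eqP/negP => /negP fi; apply: no; exists i.
move: (pihomogP mdeg d f) (ideal_pihomog hI d If) fd; move: (pihomog mdeg d f) => g gd Ig ge.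
have co j := muni_coef_dhomog j gd.
have [g0 _] := co d; rewrite subnn in g0.
have gdE : (muni g)`_d = g.@[extend (fun _ : 'I_n => 0) 1]%:MP.
  rewrite [LHS](dhomog0_const (fun _ => 0) g0); congr (_ %:MP).
  rewrite -{2}[g]muniK unmuni_eval horner_poly.
  case: (ltnP d (size (muni g))) => ds; last first.
    rewrite nth_default // meval0 big1 // => i _; rewrite expr1n mulr1.
    have [hi _] := co i; apply: (dhomog_eval0 _ hi).
    by rewrite subn_gt0; apply: leq_trans (ltn_ord i) ds.
  rewrite (bigD1 (Ordinal ds)) //= expr1n mulr1 big1 ?addr0 // => i id.
  rewrite expr1n mulr1; have [hi h0] := co i.
  case: (ltnP d i) => di; first by rewrite h0 // meval0.
  apply: (dhomog_eval0 _ hi); move: id; rewrite -val_eqE /=; lia.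
set c := g.@[_] in ge gdE.
have sz : size (muni (c^-1 *: g)) = d.+1 /\ (muni (c^-1 *: g))`_d = 1.
  have cd : (muni (c^-1 *: g))`_d = 1.
    by rewrite muniZ coefZ gdE -mpolyCM mulVf.
  split=> //; apply/eqP; rewrite eqn_leq; apply/andP; split.
    apply/leq_sizeP => j dj; rewrite muniZ coefZ; have [_ ->] := co j; by rewrite ?mulr0.
  rewrite ltnNge; apply/negP => le; move: cd; rewrite nth_default // => /eqP.
  by rewrite eq_sym oner_eq0.
case: sz => sz cd; exists d, (c^-1 *: g); split=> //; first exact: idealZ.
  exact: dhomogZ.
by rewrite monicE lead_coefE sz /= cd.
Qed.

(* If no [b] worked, some [P] in [I] would specialize to [1] at [a]; after
   division by [f], the resultant of [f] and [f + P] would lie in [I], involve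
   only the first [n] variables, and not vanish at [a]. *)
Lemma elimination n (I : {mpoly K[n.+1]} -> Prop) d f (a : 'I_n -> K) : hom_ideal I ->
  I f -> muni f \is monic -> size (muni f) = d.+2 ->
  (forall q, I (mwiden q) -> q.@[a] = 0) ->
  exists b, forall p, I p -> p.@[extend a b] = 0.
Proof.
move=> hI If fm sf az.
pose ev := map_poly (@meval n K a).
have [b hb] : exists b, forall p : {poly K}, (exists2 P, I (unmuni P) & p = ev P) -> p.[b] = 0.
  apply: poly_common_root.
  - move=> _ _ [P IP ->] [Q IQ ->]; exists (P + Q); last by rewrite /ev rmorphD.
    by rewrite unmuniD; apply: idealD.
  - move=> p _ [Q IQ ->]; exists (map_poly (@mpolyC n K) p * Q).
      by rewrite unmuniM; apply: idealM.
    rewrite /ev rmorphM /=; congr (_ * _); apply/polyP => i.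
    by rewrite !coef_map /= mevalC.
  - exists (ev (muni f)); first by exists (muni f) => //; rewrite muniK.
    by apply: monic_neq0; apply: monic_map.
  move=> [P IP e1].
  have rP := Pdiv.RingMonic.rdivp_eq fm P.
  set Q := Pdiv.Ring.rdivp _ _ in rP; set R := Pdiv.Ring.rmodp _ _ in rP.
  have sR : (size R < size (muni f))%N by rewrite Pdiv.Ring.ltn_rmodp monic_neq0.
  (* Adding [f] to the remainder makes [G] monic of the size of [f], so both leading coefficients
     survive evaluation at [a]. *)
  pose G := muni f + R.
  have sG : size G = d.+2 by rewrite size_polyDl.
  have Gm : G \is monic by rewrite monicE lead_coefDl // -monicE.
  have IG : I (unmuni G).
    rewrite (_ : G = muni f + (P + (- Q) * muni f)); last by rewrite rP mulNr addrAC subrr add0r.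
    rewrite !unmuniD unmuniM muniK; apply: idealD => //; apply: idealD => //.
    exact: idealM.
  have f1 : (1 < size (muni f))%N by rewrite sf.
  have G1 : (1 < size G)%N by rewrite sG.
  have [uv _ Ruv] := resultant_in_ideal f1 G1.
  have IR : I (mwiden (resultant (muni f) G)).
    rewrite -unmuniC Ruv unmuniD !unmuniM muniK.
    by apply: idealD => //; apply: idealM.
  have := az _ IR; rewrite resultant_map /= ?(monicP fm) ?(monicP Gm) ?rmorph1 ?oner_eq0 //.
  move/eqP; rewrite resultant_eq0; suff /eqP-> : coprimep (ev (muni f)) (ev G) by [].
  have eR : ev R = 1 - ev Q * ev (muni f).
    by rewrite e1 rP /ev !rmorphD !rmorphM /= addrAC subrr add0r.
  (* Since [ev P = 1], [ev G] equals [ev (muni f) + 1 - ev Q * ev (muni f)]. *)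
  apply/Bezout_coprimepP; exists (ev Q - 1, 1) => /=; rewrite (_ : _ + _ = 1) ?eqpxx //.
  rewrite (_ : ev G = ev (muni f) + ev R) ?eR; first by ring.
  by rewrite -eR /ev /G rmorphD.
exists b => p Ip; rewrite -[p]muniK unmuni_eval; apply: hb.
by exists (muni p) => //; rewrite muniK.
Qed.

Lemma radical_dhomog n (I : {mpoly K[n]} -> Prop) k p : hom_ideal I ->
  (forall i, radical I 'X_i) -> (0 < k)%N -> p \is k.-homog -> radical I p.
Proof.
move=> hI rX k0 hp; rewrite [p]mpolyE big_seq; apply: radical_sum => // u up.
rewrite -mul_mpolyC; apply: radicalM => //.
have [i ui] : exists i, (0 < u i)%N.
  apply: NNPP => no; move: k0; rewrite -(dhomog_mf hp up) /= mdegE big1 // => i _.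
  by apply/eqP; rewrite -leqn0 leqNgt; apply/negP => ui; apply: no; exists i.
rewrite mpolyXE_id (bigD1 i) //= mulrC -(prednK ui) exprS mulrCA.
by rewrite mulrC; apply: radicalM => //; apply: rX.
Qed.

(** Induction on the number of variables. As [(0, ..., 0, 1)] is not a zero, [I] contains a form
    monic in the last variable. By [elimination], zeros of the elimination ideal [I'] extend to
    zeros of [I], so [I'] has only the zero vector and the first variables lie in the radical. The
    lower coefficients of the monic form then lie there too, and with them the last variable. *)
Lemma nullstellensatz_radical n (I : {mpoly K[n]} -> Prop) : hom_ideal I ->
  (forall v : 'I_n -> K, (forall p, I p -> p.@[v] = 0) -> forall i, v i = 0) ->
  forall i, radical I 'X_i.
Proof.
elim: n I => [|n IHn] I hI nz; first by case.
have [|[|d] [f [If fd fm sf]]] := @monic_form n I hI.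
- by move/nz/(_ ord_max); rewrite extend_max => /eqP; rewrite oner_eq0.
- have f1 : f = 1.
    have := sf; move/eqP/size_poly1P => [c _ fc]; rewrite -[f]muniK fc unmuniC.
    by move: fm; rewrite fc monicE lead_coefC => /eqP->; rewrite rmorph1.
  by move=> i; exists 0; rewrite expr0 -f1.
pose I' q := I (mwiden q).
have hI' : hom_ideal I'.
  rewrite /I'; split.
  - by rewrite rmorph0; apply: ideal0.
  - by move=> p q Ip Iq; rewrite rmorphD; apply: idealD.
  - by move=> p q Iq; rewrite rmorphM; apply: idealM.
  - move=> k p Ip; rewrite -(pihomog_graded (@mwiden_dhomog K n)); exact: ideal_pihomog.
case: (classic (forall v : 'I_n -> K, (forall p, I' p -> p.@[v] = 0) -> forall i, v i = 0))
  => [nz'|nn].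
  have rX' := IHn I' hI' nz'.
  have rI q : radical I' q -> radical I (mwiden q).
    by move=> [N Iq]; exists N; rewrite -rmorphXn.
  have rX j : radical I (mwiden 'X_j) by apply: rI.
  suff rmax : radical I 'X_ord_max.
    move=> i; case: (unliftP ord_max i) => [j|] -> //.
    by rewrite lift_max -mwiden_var.
  suff [N IN] : radical I ('X_ord_max ^+ d.+1) by exists (d.+1 * N)%N; rewrite exprM.
  have E : f = \sum_(i < d.+2) mwiden (muni f)`_i * 'X_ord_max ^+ i.
    by rewrite -{1}[f]muniK /unmuni horner_poly sf.
  have -> : 'X_ord_max ^+ d.+1 =
      f + (-1) * \sum_(i < d.+1) mwiden (muni f)`_i * 'X_ord_max ^+ i.
    rewrite {1}E big_ord_recr /= mulN1r addrAC subrr add0r.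
    by move: fm; rewrite monicE lead_coefE sf /= => /eqP->; rewrite rmorph1 mul1r.
  apply: radicalD => //; first exact: sub_radical.
  apply: radicalM => //; apply: radical_sum => // i _; rewrite mulrC; apply: radicalM => //.
  apply: rI; have [hi _] := muni_coef_dhomog i fd; apply: (radical_dhomog hI' rX' _ hi).
  by have := ltn_ord i; lia.
case: nn => a az i.
have [b ab] := elimination hI If fm sf az.
by have := nz _ ab (widen_ord (leqnSn n) i); rewrite extend_widen.
Qed.

(** If the [N i]-th power of each variable is in [I], a monomial of degree above the sum of the
    [N i] is divisible by one of these powers. *)
Lemma nullstellensatz n (I : {mpoly K[n]} -> Prop) : hom_ideal I ->
  (forall v : 'I_n -> K, (forall p, I p -> p.@[v] = 0) -> forall i, v i = 0) ->
  exists N, forall k p, (N <= k)%N -> p \is k.-homog -> I p.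
Proof.
move=> hI /(nullstellensatz_radical hI) rX.
have [N NP] : exists N : 'I_n -> nat, forall i, I ('X_i ^+ N i).
  exact: (choice (fun i N => I ('X_i ^+ N)) rX).
exists (\sum_i N i).+1 => k p Nk hp.
rewrite [p]mpolyE big_seq; apply: ideal_sum => // u up; apply: idealZ => //.
have [i ui] : exists i, (N i <= u i)%N.
  apply: NNPP => no; move: Nk; rewrite -(dhomog_mf hp up) /= mdegE ltnNge => /negP; apply.
  apply: leq_sum => i _; case: (leqP (N i) (u i)) => [le|/ltnW//].
  by case: no; exists i.
rewrite mpolyXE_id (bigD1 i) //= -(subnK ui) exprD mulrAC.
exact: idealM.
Qed.

End Nullstellensatz.

(** * Finite sets of projective points *)

Section Points.
Variables (n : nat) (K : fieldType).
Implicit Types (v w : 'I_n.+1 -> K) (I : {mpoly K[n.+1]} -> Prop).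

Definition nonzero v := exists a, v a != 0.
(* For nonzero vectors: [v] and [w] span distinct projective points. *)
Definition indep2 v w := exists a b, v a * w b != v b * w a.

Lemma indep2C v w : indep2 v w -> indep2 w v.
Proof. by move=> [a [b ab]]; exists b, a; rewrite ![w _ * _]mulrC. Qed.

Lemma not_indep2 v w : nonzero v -> nonzero w -> ~ indep2 v w ->
  exists2 t, t != 0 & forall i, w i = t * v i.
Proof.
move=> [a va] [b wb] nvw; have E i : w i = w a / v a * v i.
  have H : v a * w i = v i * w a.
    by apply/eqP/negP => /negP ne; apply: nvw; exists a, i.
  by apply: (mulfI va); rewrite H; field.
exists (w a / v a) => //; apply: contraNneq wb => t0.
by rewrite E t0 mul0r.
Qed.

Definition family N (v : 'I_N -> 'I_n.+1 -> K) :=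
  (forall i, nonzero (v i)) /\ (forall i j, i != j -> indep2 (v i) (v j)).

(** For each [j != i] take a linear form vanishing at [v j] but not at [v i]; the product is padded
    to degree [k] by a power of a coordinate that is nonzero at [v i]. *)
Lemma separating N (v : 'I_N -> 'I_n.+1 -> K) k : family v -> (N <= k.+1)%N ->
  forall i, exists p, [/\ p \is k.-homog, p.@[v i] != 0 & forall j, j != i -> p.@[v j] = 0].
Proof.
move=> [nz ind] Nk i; have [a ia] := nz i.
have L j : exists l : {mpoly K[n.+1]},
    [/\ l \is 1.-homog, l.@[v i] != 0 & j != i -> l.@[v j] = 0].
  case: (eqVneq j i) => [_|ji].
    by exists 'X_a; split=> //; [apply: dhomog_var | rewrite mevalXU].
  have [b [c bc]] := ind _ _ ji; exists (v j b *: 'X_c - v j c *: 'X_b); split.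
  - by apply: rpredB; apply: dhomogZ; apply: dhomog_var.
  - by rewrite mevalB !mevalZ !mevalXU subr_eq0.
  - by rewrite mevalB !mevalZ !mevalXU mulrC subrr.
have [l lP] := choice _ L.
exists ((\prod_(j < N | j != i) l j) * 'X_a ^+ (k.+1 - N)); split.
- have H1 : \prod_(j < N | j != i) l j \is (\sum_(j < N | j != i) 1)%N.-homog.
    by apply: dhomog_prodr => j _; case: (lP j).
  have := dhomogM H1 (dhomogMn (k.+1 - N) (@dhomog_var K _ a)).
  rewrite mul1n sum1_card cardC1 card_ord (_ : (N.-1 + _)%N = k) //.
  by have := ltn_ord i; lia.
- rewrite rmorphM rmorphXn rmorph_prod /= mevalXU mulf_neq0 ?expf_neq0 //.
  by apply/prodf_neq0 => j _; case: (lP j).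
- move=> j ji; rewrite rmorphM rmorph_prod (bigD1 j) //=.
  by case: (lP j) => _ _ /(_ ji) ->; rewrite !mul0r.
Qed.

(** Evaluation of forms of degree [k] at the [N] points is onto by [separating], and it kills the
    piece of [I]. *)
Lemma hilb_points N (v : 'I_N -> 'I_n.+1 -> K) I k : hom_ideal I -> family v ->
  (forall i p, I p -> p.@[v i] = 0) -> (N <= k.+1)%N -> (N <= hilb I k)%N.
Proof.
move=> hI fv Iv Nk; have [p pP] := choice _ (separating fv Nk).
pose e (x : dhomog n.+1 K k) : 'rV[K]_N := \row_j (val x).@[v j].
have el : linear e.
  by move=> a x y; apply/rowP => j; rewrite !mxE /= mevalD mevalZ.
pose eM := GRing.isLinear.Build _ _ _ _ e el.
pose eL : {linear dhomog n.+1 K k -> 'rV[K]_N} := HB.pack e eM.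
pose E : 'Hom(dhomog n.+1 K k, 'rV[K]_N) := linfun eL.
have EE x j : E x 0 j = (val x).@[v j] by rewrite lfunE /= mxE.
have Es : limg E = fullv.
  apply/vspaceP => y; rewrite memvf; apply/memv_imgP.
  exists (\sum_j (y 0 j / (p j).@[v j]) *: hproj k (p j)); first exact: memvf.
  have Ep i j : E (hproj k (p i)) 0 j = (p i).@[v j].
    by rewrite EE hprojE //; case: (pP i).
  apply/rowP => j; rewrite linear_sum summxE (bigD1 j) //= big1 => [|i ij].
    by rewrite addr0 linearZ mxE Ep divfK //; case: (pP j).
  by have [_ _ pij] := pP i; rewrite linearZ mxE Ep (pij j) ?mulr0 // eq_sym.
have sub : (piece I k <= lker E)%VS.
  apply/subvP => x /(pieceP hI) Ix; rewrite memv_ker; apply/eqP/rowP => j.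
  by rewrite EE mxE; apply: Iv.
have dN : \dim (fullv : {vspace 'rV[K]_N}) = N by rewrite dimvf; exact: mul1n.
have := limg_ker_dim E fullv; rewrite capfv Es dN.
have := dimvS sub; have := hilbE I k.
move: (hilb I k) (\dim (piece I k)) (\dim (lker E)) => a b c.
move: (\dim _) => x; lia.
Qed.

Lemma extend_family N (v : 'I_N -> 'I_n.+1 -> K) w : family v -> nonzero w ->
  (forall i, indep2 (v i) w) -> family (extend v w).
Proof.
move=> [nv iv] nw iw; split=> [i|i j].
  by case: (unliftP ord_max i) => [i'|] ->; rewrite ?lift_max ?extend_widen ?extend_max.
case: (unliftP ord_max i) => [i'|] ->; case: (unliftP ord_max j) => [j'|] ->;
  rewrite ?lift_max ?extend_widen ?extend_max ?eqxx // => ij.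
- by apply: iv; apply: contraNneq ij => ->.
- exact: indep2C.
Qed.

(** By [hilb_points] in a large enough degree, no family of zeros has more than [B] members, so
    adding zeros must stop. *)
Lemma maximal_family I B : hom_ideal I -> (forall k, (hilb I k <= B)%N) ->
  exists N (v : 'I_N -> 'I_n.+1 -> K), (forall i, nonzero (v i)) /\
    forall w, nonzero w -> (forall p, I p -> p.@[w] = 0) -> exists i, ~ indep2 (v i) w.
Proof.
move=> hI hB; pose zeros N (v : 'I_N -> _) := forall i p, I p -> p.@[v i] = 0.
suff H M N (v : 'I_N -> 'I_n.+1 -> K) : (B - N < M)%N -> family v -> zeros N v ->
    exists N (v : 'I_N -> 'I_n.+1 -> K), (forall i, nonzero (v i)) /\
    forall w, nonzero w -> (forall p, I p -> p.@[w] = 0) -> exists i, ~ indep2 (v i) w.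
  by apply: (H B.+1 0 (fun=> fun=> 0)); rewrite ?subn0 //; [split; case | case].
elim: M N v => [//|M IHM] N v NB fv Iv.
case: (classic (exists w, [/\ nonzero w, forall p, I p -> p.@[w] = 0 &
    forall i, indep2 (v i) w])) => [[w [nw Iw iw]]|no].
  have fe := extend_family fv nw iw.
  have Ie : zeros N.+1 (extend v w).
    move=> i p; case: (unliftP ord_max i) => [i'|] ->; rewrite ?lift_max ?extend_widen ?extend_max;
      [exact: Iv | exact: Iw].
  apply: (IHM _ _ _ fe Ie).
  by have := hilb_points hI fe Ie (leqnSn _); have := hB N.+1; lia.
exists N, v; split=> [|w nw Iw]; first by case: fv.
apply: NNPP => ni; apply: no; exists w; split=> // i.
by apply: NNPP => nii; apply: ni; exists i.
Qed.

End Points.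

(* The coefficients are taken on the moment curve, which turns the condition into
   the nonvanishing of a univariate polynomial. *)
Lemma avoid_hyperplane (K : closedFieldType) n N (v : 'I_N -> 'I_n.+2 -> K) :
  (forall i, nonzero (v i)) ->
  exists c, forall i w, nonzero w -> ~ indep2 (v i) w -> (hyperplane c).@[w] != 0.
Proof.
move=> nv; pose q i : {poly K} :=
  (v i ord_max)%:P - \sum_(j < n.+1) v i (widen_ord (leqnSn n.+1) j) *: 'X^(j.+1).
have qE i t : (q i).[t] = (hyperplane (fun j : 'I_n.+1 => t ^+ j.+1)).@[v i].
  rewrite hyperplane_eval hornerD hornerN hornerC horner_sum; congr (_ - _).
  by apply: eq_bigr => j _; rewrite hornerZ hornerXn mulrC.
have q0 i : q i != 0.
  have [a va] := nv i; apply: contraNneq va => q0.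
  have co k : (q i)`_k = 0 by rewrite q0 coef0.
  case: (unliftP ord_max a) => [j|] ->; last first.
    move: (co 0); rewrite coefB coefC coef_sum big1 ?subr0 => [->//|j _].
    by rewrite coefZ coefXn mulr0.
  move: (co j.+1); rewrite coefB coefC sub0r coef_sum (bigD1 j) //= big1 => [|l lj].
    by rewrite addr0 coefZ coefXn eqxx mulr1 lift_max => /eqP; rewrite oppr_eq0.
  rewrite coefZ coefXn eqSS (_ : (_ == _) = false) ?mulr0 //.
  by apply/negbTE; apply: contraNneq lj => e; apply/eqP/val_inj.
have /closed_nonrootP[t] : \prod_i q i != 0 by apply/prodf_neq0.
rewrite rootE horner_prod => /prodf_neq0 qt.
exists (fun j => t ^+ j.+1) => i w nw niw.
have [s s0 sE] := not_indep2 (nv i) nw niw.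
have -> : (hyperplane (fun j : 'I_n.+1 => t ^+ j.+1)).@[w] =
    s ^+ 1 * (hyperplane (fun j : 'I_n.+1 => t ^+ j.+1)).@[v i].
  rewrite -(meval_scale _ _ (hyperplane_dhomog _)); exact: meval_eq.
by rewrite expr1 mulf_neq0 // -qE; apply: qt.
Qed.

(** * Regular sequences and Bezout's bound *)

Section Regular.
Variables (n : nat) (K : fieldType).
Local Notation S := {mpoly K[n]}.
Implicit Types (I : S -> Prop) (fs : seq S) (f l : S).

Definition regular I f := forall u, I (u * f) -> I u.

Fixpoint ideal_gen I fs : S -> Prop := if fs is f :: fs' then ideal_gen (adjoin I f) fs' else I.

Fixpoint regseq I fs : Prop :=
  if fs is f :: fs' then regular I f /\ regseq (adjoin I f) fs' else True.

Definition homogs fs := forall f, f \in fs -> exists d, f \is d.-homog.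

Lemma homogs_cons f fs : homogs (f :: fs) -> (exists d, f \is d.-homog) /\ homogs fs.
Proof. by move=> H; split=> [|g gfs]; apply: H; rewrite inE ?eqxx ?gfs ?orbT. Qed.

Lemma ideal_gen_ideal I fs : hom_ideal I -> homogs fs -> hom_ideal (ideal_gen I fs).
Proof.
elim: fs I => [//|f fs IH] I hI /homogs_cons[[d fd] hfs] /=.
by apply: IH => //; apply: adjoin_ideal fd.
Qed.

Lemma ideal_gen_rcons I fs f : ideal_gen I (rcons fs f) = adjoin (ideal_gen I fs) f.
Proof. by elim: fs I => [//|g fs IH] I /=. Qed.

Lemma regseq_rcons I fs f : regseq I fs -> regular (ideal_gen I fs) f -> regseq I (rcons fs f).
Proof. by elim: fs I => [|g fs IH] I /= => [_ //|[rg rs] rf]; split=> //; apply: IH. Qed.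

Lemma ideal_gen_adjoin I l fs : ideal_gen (adjoin I l) fs = adjoin (ideal_gen I fs) l.
Proof. by elim: fs I => [//|f fs IH] I /=; rewrite adjoinC IH. Qed.

Lemma ideal_gen_eval I fs (v : 'I_n -> K) : (forall p, I p -> p.@[v] = 0) ->
  (forall f, f \in fs -> f.@[v] = 0) -> forall p, ideal_gen I fs p -> p.@[v] = 0.
Proof.
elim: fs I => [//|f fs IH] I Iv fv /=; apply: IH => [_ [i [g [Ii ->]]]|g gfs].
  by rewrite mevalD mevalM (Iv i Ii) (fv f (mem_head f fs)) mulr0 addr0.
by apply: fv; rewrite inE gfs orbT.
Qed.

Lemma sub_ideal_gen I fs p : I p -> ideal_gen I fs p.
Proof. by elim: fs I => [//|f fs IH] I Ip /=; apply: IH; apply: sub_adjoin. Qed.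

Lemma mem_ideal_gen I fs f : hom_ideal I -> homogs fs -> f \in fs -> ideal_gen I fs f.
Proof.
elim: fs I => [//|g fs IH] I hI /homogs_cons[[d gd] hfs] /=; rewrite inE => /orP[/eqP->|ffs].
  by apply: sub_ideal_gen; apply: adjoin_gen.
by apply: IH => //; apply: adjoin_ideal gd.
Qed.

(* A form [f] regular modulo [(I, l)] is regular modulo [I]: if [u f] is in [I]
   then [u = i + g l], so [g f] is in [I] and [g] has smaller degree. *)
Lemma regular_swap I e d l f : hom_ideal I -> (0 < e)%N -> l \is e.-homog -> f \is d.-homog ->
  regular I l -> regular (adjoin I l) f -> regular I f /\ regular (adjoin I f) l.
Proof.
move=> hI e0 le fd rl rf.
have H k : forall u, u \is k.-homog -> I (u * f) -> I u.
  elim/ltn_ind: k => k IHk u uk Iuf.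
  have [i [g [Ii eu]]] : adjoin I l u by apply: rf; apply: sub_adjoin.
  have Iik : I (pihomog mdeg k i) by apply: ideal_pihomog.
  move: eu => /(congr1 (pihomog mdeg k)); rewrite (pihomog_dE uk) linearD /=.
  rewrite (pihomog_mulr _ _ le); case: leqP => [ek|_ ->]; last by rewrite addr0.
  set h := pihomog _ _ g => eu; rewrite eu; apply: idealD => //; rewrite mulrC; apply: idealM => //.
  apply: (IHk (k - e)%N); [lia | exact: pihomogP |].
  apply: rl; rewrite mulrAC (_ : h * l * f = u * f - pihomog mdeg k i * f).
    by apply: idealB => //; rewrite mulrC; apply: idealM.
  by rewrite eu mulrDl addrAC subrr add0r.
have RF : regular I f.
  move=> u Iuf; apply: ideal_components => // k; apply: (H k); first exact: pihomogP.
  by have := ideal_pihomog hI (k + d) Iuf; rewrite (pihomog_mulr _ _ fd) leq_addl addnK.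
split=> // u [i [v [Ii eu]]].
have [j [w [Ij ev]]] : adjoin I l v.
  apply: rf; exists (- i), u; rewrite eu; split; last by rewrite addrA addNr add0r.
  by rewrite -mulN1r; apply: idealM.
exists (u - w * f), w; rewrite subrK; split=> //; apply: rl.
rewrite mulrBl eu ev (_ : _ - _ = i + f * j); last by ring.
by apply: idealD => //; apply: idealM.
Qed.

(** Iterates [regular_swap] to carry [l] from the front of the sequence past every member of
    [fs]. *)
Lemma regseq_swap I e l fs : hom_ideal I -> (0 < e)%N -> l \is e.-homog -> homogs fs ->
  regular I l -> regseq (adjoin I l) fs -> regseq I fs /\ regular (ideal_gen I fs) l.
Proof.
move=> + e0 le; elim: fs I => [//|f fs IH] I hI /homogs_cons[[d fd] hfs] rl /= [rf rfs].
have [rIf rl'] := regular_swap hI e0 le fd rl rf.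
rewrite adjoinC in rfs; have [rs rl''] := IH _ (adjoin_ideal hI fd) hfs rl' rfs.
by [].
Qed.

End Regular.

Section RegularRestriction.
Variables (n : nat) (K : fieldType) (c : 'I_n.+1 -> K).

Lemma ideal_gen_restrict J (fs : seq {mpoly K[n.+2]}) :
  (fun p => ideal_gen J (map (restrict c) fs) (restrict c p)) =
  ideal_gen (fun p => J (restrict c p)) fs.
Proof. by elim: fs J => [//|f fs IH] J /=; rewrite IH restrict_adjoin. Qed.

Lemma regseq_restrict J (fs : seq {mpoly K[n.+2]}) :
  regseq J (map (restrict c) fs) -> regseq (fun p => J (restrict c p)) fs.
Proof.
elim: fs J => [//|f fs IH] J /= [rf rs]; split.
  by move=> u Ju; apply: rf; rewrite -rmorphM.
by rewrite -restrict_adjoin; apply: IH.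
Qed.

Lemma hyperplane_neq0 : hyperplane c != 0.
Proof.
apply: contraTneq (oner_neq0 K) => h0; rewrite negbK.
have := congr1 (meval (extend (fun=> 0) 1)) h0; rewrite hyperplane_eval extend_max meval0.
rewrite big1 ?subr0 => [-> //|j _]; by rewrite extend_widen mulr0.
Qed.

End RegularRestriction.

Section HilbertSums.
Variables (n : nat) (K : fieldType).
Local Notation S := {mpoly K[n.+1]}.
Implicit Types (I : S -> Prop) (fs : seq S) (f l : S).

Lemma hilb_regular I d f k : hom_ideal I -> f \is d.-homog -> regular I f ->
  (hilb (adjoin I f) (k + d) + hilb I k = hilb I (k + d))%N.
Proof.
move=> hI fd rf; rewrite -(hilb_colon _ hI fd); congr (_ + hilb _ _)%N.
apply: functional_extensionality => p; apply: propositional_extensionality.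
by split; [exact: sub_colon | exact: rf].
Qed.

Lemma hilb_adjoin_le I d f k : hom_ideal I -> f \is d.-homog -> (hilb (adjoin I f) k <= hilb I k)%N.
Proof. by move=> hI fd; apply: (hilb_anti hI (adjoin_ideal hI fd)) => p _; apply: sub_adjoin. Qed.

Lemma sum_window (a : nat -> nat) M d :
  (\sum_(M.+1 <= k < (M + d).+1) a k + a M = \sum_(M <= k < M + d) a k + a (M + d))%N.
Proof.
rewrite -big_nat_recr /= ?leq_addr // [RHS]big_ltn ?ltnS ?leq_addr //.
exact: addnC.
Qed.

(** By regularity [hilb (adjoin I f)] is the difference of [hilb I] at distance [d]. The sum
    telescopes to [d] consecutive values of [hilb I], each at most [B]. *)
Lemma sum_hilb_adjoin I d f B : hom_ideal I -> f \is d.-homog -> regular I f ->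
  (forall k, (hilb I k <= B)%N) -> forall L, (\sum_(k < L) hilb (adjoin I f) k <= d * B)%N.
Proof.
move=> hI fd rf hB L.
have H M : (\sum_(k < M + d) hilb (adjoin I f) k <= \sum_(M <= k < M + d) hilb I k)%N.
  elim: M => [|M IHM].
    by rewrite add0n big_mkord; apply: leq_sum => k _; apply: hilb_adjoin_le fd.
  rewrite addSn big_ord_recr /=; have := hilb_regular M hI fd rf.
  by move=> e; rewrite -(leq_add2r (hilb I M)) (sum_window (hilb I)) -addnA e leq_add2r.
apply: leq_trans (leq_trans (H L) _).
  by rewrite big_split_ord /= leq_addr.
by rewrite -[d in (d * B)%N](addKn L) -sum_nat_const_nat; apply: leq_sum.
Qed.

(** By [hilb_colon], and because [(I : l)] contains [I], each step in degree increases [hilb I] by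
    at most the new value of [hilb (adjoin I l)]. *)
Lemma hilb_le_sum I l : hom_ideal I -> l \is 1.-homog ->
  forall k, (hilb I k <= \sum_(j < k.+1) hilb (adjoin I l) j)%N.
Proof.
move=> hI l1; elim=> [|k IHk].
  rewrite big_ord_recr big_ord0 /= add0n.
  apply: (hilb_anti (adjoin_ideal hI l1) hI) => p p0 [i [g [Ii e]]].
  move: e => /(congr1 (pihomog mdeg 0)); rewrite (pihomog_dE p0) linearD /=.
  by rewrite (pihomog_mulr _ _ l1) /= addr0 => ->; apply: ideal_pihomog.
rewrite big_ord_recr /=; have := hilb_colon k hI l1; rewrite addn1 => <-.
rewrite addnC leq_add2r; apply: leq_trans IHk.
by apply: (hilb_anti hI (colon_ideal hI l1)) => p _; apply: sub_colon.
Qed.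

Lemma hilb_regular_mono I l k i : hom_ideal I -> l \is 1.-homog -> regular I l ->
  (hilb I k <= hilb I (k + i))%N.
Proof.
move=> hI l1 rl; elim: i => [|i IHi]; first by rewrite addn0.
by have := hilb_regular (k + i) hI l1 rl; rewrite addn1 addnS; lia.
Qed.

End HilbertSums.

Section Bezout.
Variable (K : closedFieldType).

Local Notation zero_ideal := (fun p => p = 0).

Lemma extend_eq0 n (a : 'I_n -> K) b : (forall i, extend a b i = 0) -> forall i, a i = 0.
Proof. by move=> H i; have := H (widen_ord (leqnSn n) i); rewrite extend_widen. Qed.

Lemma restrict_no_zero n (c : 'I_n.+1 -> K) (I : {mpoly K[n.+2]} -> Prop) :
  (forall w, nonzero w -> (forall p, I p -> p.@[w] = 0) -> (hyperplane c).@[w] != 0) ->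
  forall a, (forall p, I p -> (restrict c p).@[a] = 0) -> forall i, a i = 0.
Proof.
move=> hc a az; apply: (@extend_eq0 _ a (\sum_j c j * a j)) => i.
apply: NNPP => /eqP ne; have := hc _ (ex_intro _ i ne).
move=> H; have /H/negP[] : forall p, I p -> p.@[extend a (\sum_j c j * a j)] = 0.
  by move=> p Ip; rewrite -restrict_eval; apply: az.
by rewrite -restrict_eval restrict_hyperplane meval0.
Qed.

Lemma restrict_zero_ideal n (c : 'I_n.+1 -> K) fs :
  (fun p => ideal_gen zero_ideal (map (restrict c) fs) (restrict c p)) =
  ideal_gen (adjoin zero_ideal (hyperplane c)) fs.
Proof. by rewrite ideal_gen_restrict restrict_ker. Qed.

Lemma hilb_restrict_sum n (c : 'I_n.+1 -> K) fs k : homogs fs ->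
  (hilb (ideal_gen zero_ideal fs) k
   <= \sum_(j < k.+1) hilb (ideal_gen zero_ideal (map (restrict c) fs)) j)%N.
Proof.
move=> hfs; have hI := ideal_gen_ideal (zero_is_ideal _ _) hfs.
have hT : hom_ideal (ideal_gen zero_ideal (map (restrict c) fs)).
  apply: ideal_gen_ideal; first exact: zero_is_ideal.
  by move=> _ /mapP[f /hfs[d fd] ->]; exists d; apply: restrict_dhomog.
apply: leq_trans (hilb_le_sum hI (hyperplane_dhomog c) k) _.
apply: leq_sum => j _; rewrite -(hilb_restrict c _ hT) restrict_zero_ideal ideal_gen_adjoin.
exact: leqnn.
Qed.

Lemma bounded_step n (I : {mpoly K[n.+1]} -> Prop) d N : (0 < d)%N ->
  (forall k, (N <= k + d)%N -> (hilb I (k + d) <= hilb I k)%N) ->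
  exists B, forall k, (hilb I k <= B)%N.
Proof.
move=> d0 H; exists (\sum_(j < N + d) hilb I j)%N => k.
elim/ltn_ind: k => k IHk; case: (ltnP k (N + d)) => lt.
  by rewrite (bigD1 (Ordinal lt)) //= leq_addr.
have e : k = (k - d + d)%N by lia.
rewrite e; apply: leq_trans (H _ _) _; first by lia.
by apply: IHk; lia.
Qed.

(** Induction on the number of variables. The forms [gs] other than the last have finitely many
    projective zeros, so some hyperplane avoids them, and the induction hypothesis applies to the
    restriction of [gs]. It bounds the Hilbert function of [gs] by [d ^ n.+1]; adjoining the last
    form bounds the total dimension by [d] times as much. *)
Theorem complete_intersection n d (fs : seq {mpoly K[n.+1]}) : (0 < d)%N ->
  size fs = n.+1 -> (forall f, f \in fs -> f \is d.-homog) ->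
  (forall v : 'I_n.+1 -> K, (forall f, f \in fs -> f.@[v] = 0) -> forall i, v i = 0) ->
  regseq zero_ideal fs /\ forall L, (\sum_(k < L) hilb (ideal_gen zero_ideal fs) k <= d ^ n.+1)%N.
Proof.
move=> d0; elim: n fs => [|n IHn] fs.
  case: fs => [//|f [|//]] _ fd nz; have {fd}fd : f \is d.-homog by apply: fd; rewrite inE.
  have rf : regular zero_ideal f.
    move=> u /eqP; rewrite mulf_eq0 => /orP[/eqP//|/eqP f0].
    have := nz (fun=> 1) _ ord0; rewrite f0 => /(_ _)/eqP; rewrite oner_eq0 => H.
    by exfalso; apply: notF; apply: H => g; rewrite inE => /eqP->; rewrite meval0.
  split=> //= L; rewrite expn1 -[X in (_ <= X)%N]muln1.
  apply: (sum_hilb_adjoin (zero_is_ideal _ _) fd rf) => k.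
  by rewrite leq_subLR dim_dhomog addn0 binn addn1.
case/lastP: fs => [//|gs f]; rewrite size_rcons => -[sg] hd nz.
have fd : f \is d.-homog by apply: hd; rewrite mem_rcons inE eqxx.
have gd g : g \in gs -> g \is d.-homog by move=> gg; apply: hd; rewrite mem_rcons inE gg orbT.
have hgs : homogs gs by move=> g /gd; exists d.
pose I := ideal_gen zero_ideal gs.
have hI : hom_ideal I by apply: ideal_gen_ideal => //; apply: zero_is_ideal.
have hA := adjoin_ideal hI fd.
have [N0 NS] : exists N, forall k p, (N <= k)%N -> p \is k.-homog -> adjoin I f p.
  apply: nullstellensatz => // v vz; apply: nz => g.
  rewrite mem_rcons inE => /orP[/eqP->|ggs]; apply: vz; first exact: adjoin_gen.
  by apply: sub_adjoin; apply: mem_ideal_gen => //; apply: zero_is_ideal.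
have hfA k : (N0 <= k)%N -> hilb (adjoin I f) k = 0%N.
  by move=> Nk; apply: hilb_full => // p; apply: NS.
have hC := colon_ideal hI fd.
(* As [(I, f)] is everything in large degrees, [hilb I (k + d)] is there [hilb (colon I f) k], which
   is at most [hilb I k]. *)
have [B hB] : exists B, forall k, (hilb I k <= B)%N.
  apply: (@bounded_step _ _ d N0) => // k Nk.
  have := hilb_colon k hI fd; rewrite hfA // add0n => <-.
  by apply: (hilb_anti hI hC) => p _; apply: sub_colon.
have [c hc] : exists c, forall w,
    nonzero w -> (forall p, I p -> p.@[w] = 0) -> (hyperplane c).@[w] != 0.
  have [N [v [nv vmax]]] := maximal_family hI hB.
  have [c cP] := avoid_hyperplane nv; exists c => w nw Iw.
  by have [i iw] := vmax w nw Iw; apply: cP iw.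
have hl := hyperplane_dhomog c.
have [reg tot] : regseq zero_ideal (map (restrict c) gs) /\
    forall L, (\sum_(k < L) hilb (ideal_gen zero_ideal (map (restrict c) gs)) k <= d ^ n.+1)%N.
  apply: IHn; first by rewrite size_map.
    by move=> _ /mapP[g /gd g_d ->]; apply: restrict_dhomog.
  move=> a az; apply: (restrict_no_zero hc) => p; rewrite /I => Ip.
  have : ideal_gen zero_ideal (map (restrict c) gs) (restrict c p).
    suff : adjoin I (hyperplane c) p by rewrite /I -ideal_gen_adjoin -restrict_zero_ideal.
    exact: sub_adjoin.
  by move: (restrict c p); apply: ideal_gen_eval => // q ->; rewrite meval0.
have rl : regular zero_ideal (hyperplane c).
  by move=> u /eqP; rewrite mulf_eq0 (negbTE (hyperplane_neq0 c)) orbF => /eqP.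
(* Regularity of the restricted forms says that the hyperplane followed by [gs] is a regular
   sequence; the hyperplane is now moved to the end. *)
have [rgs rlI] : regseq zero_ideal gs /\ regular I (hyperplane c).
  have := regseq_swap (zero_is_ideal n.+2 K) (ltn0Sn 0) hl hgs rl; apply.
  by rewrite -restrict_ker; exact: (regseq_restrict (J := zero_ideal)).
have hdn k : (hilb I k <= d ^ n.+1)%N := leq_trans (hilb_restrict_sum c k hgs) (tot _).
(* In large degrees [S/I] has constant dimension and multiplication by [f] is
   surjective on it, hence injective; regularity of the hyperplane carries this down. *)
have rf : regular I f.
  move=> u Iuf; apply: ideal_components => // k.
  have Ik : I (pihomog mdeg k u * f).
    by have := ideal_pihomog hI (k + d) Iuf; rewrite (pihomog_mulr _ _ fd) leq_addl addnK.
  move: (pihomogP mdeg k u) Ik {Iuf}; move: (pihomog mdeg k u) => {}u uk Iuf.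
  suff : I (u * hyperplane c ^+ N0).
    elim: N0 {NS hfA} => [|i IHi]; first by rewrite mulr1.
    by rewrite exprSr mulrA => /rlI.
  have ukN : u * hyperplane c ^+ N0 \is (k + N0).-homog.
    by apply: dhomogM => //; have := dhomogMn N0 hl; rewrite mul1n.
  apply: (hilb_le_sub hI hC _ _ ukN); first by move=> p _; apply: sub_colon.
    have := hilb_colon (k + N0) hI fd; rewrite hfA ?add0n => [->|]; last by lia.
    exact: hilb_regular_mono hl rlI.
  by rewrite /colon mulrAC mulrC; apply: idealM.
split; first exact: regseq_rcons.
by move=> L; rewrite ideal_gen_rcons expnS; apply: sum_hilb_adjoin.
Qed.

(** The number of points is at most the Hilbert function in degree [N], hence at most the total
    dimension of the quotient restricted to the avoiding hyperplane, which is a complete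
    intersection without zeros. *)
Theorem bezout n d N (fs : seq {mpoly K[n.+2]}) c (v : 'I_N -> 'I_n.+2 -> K) : (0 < d)%N ->
  size fs = n.+1 -> (forall f, f \in fs -> f \is d.-homog) ->
  (forall w, nonzero w -> (forall f, f \in fs -> f.@[w] = 0) -> (hyperplane c).@[w] != 0) ->
  family v -> (forall i f, f \in fs -> f.@[v i] = 0) -> (N <= d ^ n.+1)%N.
Proof.
move=> d0 sf fd hc fv vz; have hfs : homogs fs by move=> f /fd; exists d.
have hI := ideal_gen_ideal (@zero_is_ideal _ K) hfs.
apply: leq_trans (hilb_points hI fv _ (leqnSn N)) _.
  by move=> i; apply: ideal_gen_eval; [move=> _ ->; rewrite meval0 | exact: vz].
apply: leq_trans (hilb_restrict_sum c N hfs) _.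
apply: (proj2 (complete_intersection d0 _ _ _)); first by rewrite size_map.
  by move=> _ /mapP[f /fd f_d ->]; apply: restrict_dhomog.
move=> a az; apply: (restrict_no_zero (I := fun p => p \in fs) (c := c) hc) => p pfs.
by apply: az; apply: map_f.
Qed.

End Bezout.

(** * Binary forms *)

Lemma mpolyXU_neq0 (K : fieldType) n (i : 'I_n) : ('X_i : {mpoly K[n]}) != 0.
Proof.
apply/eqP => /(congr1 (meval (fun=> 1))) /eqP.
by rewrite mevalXU meval0 oner_eq0.
Qed.

Section BinaryForms.
Variable (K : fieldType).
Local Notation T k := (dhomog 2 K k).

Lemma dim_binary k : \dim {:T k} = k.+1.
Proof. by rewrite dim_dhomog addn1 binSn. Qed.

Definition mulX (i : 'I_2) k : 'Hom(T k, T k.+1) := linfun (@mulH 1 K 'X_i k k.+1).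

Lemma mulXE i k (x : T k) : val (mulX i k x) = val x * 'X_i.
Proof.
by rewrite lfunE hprojE //; have := dhomogM (dhomog_is_dhomog x) (dhomog_var K i); rewrite addn1.
Qed.

Lemma lker_mulX i k : lker (mulX i k) == 0%VS.
Proof.
apply/lker0P => x y /(congr1 val); rewrite !mulXE => e; apply/val_inj.
exact: (mulIf (mpolyXU_neq0 _ _) e).
Qed.

Lemma hyperplane_zero : hyperplane (fun _ : 'I_1 => 0 : K) = 'X_ord_max.
Proof. by rewrite /hyperplane /lform big1 ?rmorph0 ?subr0 // => j _; rewrite scale0r. Qed.

(** Setting the last variable to zero, that is, restricting with [c = 0], kills the right side and
    therefore [u]. *)
Lemma mul_vars_eq (u v : {mpoly K[2]}) :
  u * 'X_ord0 = v * 'X_ord_max -> exists w, u = w * 'X_ord_max.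
Proof.
move=> e; have [g ug] := restrict_decomp (fun=> 0) u; exists g.
rewrite {1}ug hyperplane_zero (_ : restrict _ u = 0) ?rmorph0 ?add0r //.
have /eqP := congr1 (restrict (fun=> 0)) e.
rewrite !rmorphM /= -[in X in X -> _]hyperplane_zero restrict_hyperplane mulr0.
rewrite mulf_eq0 => /orP[/eqP//|].
rewrite restrict_var (_ : ord0 = widen_ord (leqnSn 1) ord0); last exact/val_inj.
by rewrite extend_widen (negbTE (mpolyXU_neq0 _ _)).
Qed.

Lemma cap_mulX0 (U : {vspace T 0}) : (mulX ord0 0 @: U :&: mulX ord_max 0 @: U = 0)%VS.
Proof.
apply/eqP; rewrite -subv0; apply/subvP => z /memv_capP[/memv_imgP[u _ zu] /memv_imgP[v _ zv]].
have := congr1 val zu; rewrite zv !mulXE => /esym/mul_vars_eq[w uw].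
have u0 : val u = 0.
  rewrite -(pihomog_dE (dhomog_is_dhomog u)) uw (pihomog_mulr _ _ (@dhomog_var K _ ord_max)).
  by [].
by rewrite memv0 -zv zu; apply/eqP/val_inj; rewrite mulXE u0 mul0r.
Qed.

Definition lower k (U : {vspace T k.+1}) : {vspace T k} :=
  (mulX ord0 k @^-1: U :&: mulX ord_max k @^-1: U)%VS.

Lemma mulX_lower k (U : {vspace T k.+1}) i : (mulX i k @: lower U <= U)%VS.
Proof.
apply/subvP => z /memv_imgP[w /memv_capP[w0 w1] ->]; move: w0 w1; rewrite -!memv_preim => w0 w1.
case: (unliftP ord_max i) => [j|] -> //; rewrite lift_max ord1.
by rewrite (_ : widen_ord _ _ = ord0) //; apply/val_inj.
Qed.

(** The variables are coprime: if [u x_0 = v x_1] then [u = w x_1] and [v = w x_0]. Thus the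
    intersection is [x_0 x_1] times [lower U]. *)
Lemma dim_lower k (U : {vspace T k.+1}) :
  \dim (mulX ord0 k.+1 @: U :&: mulX ord_max k.+1 @: U) = \dim (lower U).
Proof.
have ek i j : (lower U :&: lker (mulX i k.+1 \o mulX j k)%VF = 0)%VS.
  apply/eqP; rewrite -subv0; apply: subv_trans (capvSr _ _) _; rewrite subv0.
  apply/lker0P => x y; rewrite !comp_lfunE => e.
  by apply: (lker0P (lker_mulX j k)); apply: (lker0P (lker_mulX i k.+1)).
rewrite -(limg_dim_eq (ek ord0 ord_max)); congr (\dim _).
apply/vspaceP => z; apply/idP/idP.
  move/memv_capP => [/memv_imgP[u uU zu] /memv_imgP[v vU zv]].
  have euv : val u * 'X_ord0 = val v * 'X_ord_max by rewrite -!mulXE -zu zv.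
  have [w uw] := mul_vars_eq euv.
  pose w' : T k := hproj k w.
  have uw' : u = mulX ord_max k w'.
    apply/val_inj; rewrite mulXE -(pihomog_dE (dhomog_is_dhomog u)) uw.
    by rewrite (pihomog_mulr _ _ (@dhomog_var K _ ord_max)) /= subn1.
  have vw' : v = mulX ord0 k w'.
    apply/val_inj; apply: (@mulIf _ 'X_ord_max); first exact: mpolyXU_neq0.
    by rewrite mulXE -euv uw' mulXE mulrAC.
  apply/memv_imgP; exists w'; last by rewrite comp_lfunE -uw'.
  by apply/memv_capP; rewrite -!memv_preim -uw' -vw'.
move/memv_imgP => [w /memv_capP[]]; rewrite -!memv_preim => w0 w1 ->.
apply/memv_capP; split; rewrite comp_lfunE; first exact: memv_img.
apply/memv_imgP; exists (mulX ord0 k w) => //; apply/val_inj.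
by rewrite !mulXE mulrAC.
Qed.

Definition raise k (U : {vspace T k}) : {vspace T k.+1} :=
  (mulX ord0 k @: U + mulX ord_max k @: U)%VS.

Lemma dim_raise_cap k (U : {vspace T k}) :
  (\dim (raise U) + \dim (mulX ord0 k @: U :&: mulX ord_max k @: U) = \dim U + \dim U)%N.
Proof.
rewrite dimv_sum_cap !limg_dim_eq //; apply/eqP; rewrite -subv0.
  by apply: subv_trans (capvSr _ _) _; rewrite (eqP (lker_mulX _ _)).
by apply: subv_trans (capvSr _ _) _; rewrite (eqP (lker_mulX _ _)).
Qed.

Lemma raise_sub k (U : {vspace T k}) (V : {vspace T k.+1}) :
  (forall i, (mulX i k @: U <= V)%VS) -> (raise U <= V)%VS.
Proof. by move=> H; rewrite subv_add !H. Qed.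

(** Otherwise [dim_raise_cap] makes [lower U] at least as large as [U]. By induction
    [raise (lower U)] is strictly larger than [lower U], yet it is contained in [U]. *)
Lemma dim_raise k (U : {vspace T k}) : U != 0%VS -> (\dim U < \dim (raise U))%N.
Proof.
elim: k U => [|k IHk] U; rewrite -dimv_eq0 => U0; have := dim_raise_cap U.
  by rewrite cap_mulX0 dimv0 addn0; move: (\dim _) (\dim _) U0 => a b; lia.
rewrite dim_lower => e; rewrite ltnNge; apply/negP => le.
have le' : (\dim U <= \dim (lower U))%N by move: (\dim U) (\dim _) (\dim _) e le => a b c; lia.
have D0 : lower U != 0%VS by rewrite -dimv_eq0 -lt0n; apply: leq_trans le'; rewrite lt0n.
have := IHk _ D0; have := dimvS (raise_sub (mulX_lower U)).
by move=> le1 lt; have := leq_trans lt (leq_trans le1 le'); rewrite ltnn.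
Qed.

Lemma raise_full k : raise (fullv : {vspace T k}) = fullv.
Proof.
apply/eqP; rewrite -(dimv_leqif_eq (subvf _)) eqn_leq dimvS ?subvf //=.
have f0 : (fullv : {vspace T k}) != 0%VS by rewrite -dimv_eq0 dim_binary.
by have := dim_raise f0; rewrite !dim_binary.
Qed.

End BinaryForms.

(** * Base points of spaces of binary forms *)

Section BasePoints.
Variable (K : closedFieldType).
Local Notation T k := (dhomog 2 K k).

Lemma hilb_zero n k : hilb (fun p : {mpoly K[n.+1]} => p = 0) k = 'C(k + n, k).
Proof.
rewrite -(dim_dhomog n K k) -(hilbE (fun p => p = 0) k) (_ : piece _ _ = 0%VS) ?dimv0 ?addn0 //.
apply/eqP; rewrite -subv0; apply/subvP => x /(pieceP (zero_is_ideal _ _)) x0.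
by rewrite memv0; apply/eqP/val_inj.
Qed.

(** Without a zero, all forms of some degree [N + k.+1] would be multiples of [g]. The multiples
    have dimension at most [N.+1], the forms [N + k + 2]. *)
Lemma binary_form_zero k (g : {mpoly K[2]}) : g \is k.+1.-homog ->
  exists2 a : 'I_2 -> K, nonzero a & g.@[a] = 0.
Proof.
move=> gk; apply: NNPP => no.
have hA := adjoin_ideal (zero_is_ideal 2 K) gk.
have [N NP] : exists N, forall k p, (N <= k)%N -> p \is k.-homog -> adjoin (fun p => p = 0) g p.
  apply: nullstellensatz => // v vz i; apply: NNPP => /eqP vi; apply: no.
  by exists v; [exists i | apply: vz; apply: adjoin_gen; apply: zero_is_ideal].
have := hilb_colon N (zero_is_ideal 2 K) gk; rewrite hilb_full ?add0n //; last first.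
  by move=> p; apply: NP; rewrite leq_addr.
move=> e; have : (hilb (colon (fun p : {mpoly K[2]} => p = 0%R) g) N <= N.+1)%N.
  by apply: leq_trans (leq_subr _ _) _; rewrite dim_binary.
rewrite e hilb_zero addn1 binSn; lia.
Qed.

Lemma line_zero k (V : {vspace T k.+1}) : (\dim V <= 1)%N ->
  exists2 a : 'I_2 -> K, nonzero a & forall p : T k.+1, p \in V -> (val p).@[a] = 0.
Proof.
move=> dV; have [a a0 az] := binary_form_zero (dhomog_is_dhomog (vpick V)); exists a => // p.
have /eqP <- : (<[vpick V]>%VS == V).
  rewrite eqEdim -memvE memv_pick dim_vline vpick0 -dimv_eq0 /=.
  by move: dV; case: (\dim V) => [|[]].
by move/vlineP => [t ->]; rewrite /= mevalZ az mulr0.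
Qed.

(* Induction on the degree: [U] and [lower U] again satisfy the dimension
   hypothesis, and a common zero of [U] is one of [raise U], which fills [V]. *)
Lemma common_zero k (U : {vspace T k}) (V : {vspace T k.+1}) :
  (forall i, (mulX K i k @: U <= V)%VS) -> U != fullv -> (\dim V <= (\dim U).+1)%N ->
  exists2 a : 'I_2 -> K, nonzero a & forall p : T k.+1, p \in V -> (val p).@[a] = 0.
Proof.
elim: k U V => [|k IHk] U V UV Uf dV; have [U0|U0] := eqVneq U 0%VS.
1,3: by apply: line_zero; move: dV; rewrite U0 dimv0.
- case/eqP: Uf; apply/eqP; rewrite -(dimv_leqif_eq (subvf _)) dim_binary.
  by move: U0 (dimvS (subvf U)); rewrite -dimv_eq0 dim_binary; case: (\dim U) => [|[]].
have dr := dimvS (raise_sub UV).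
have := dim_raise_cap U; rewrite dim_lower => e.
have [a a0 az] : exists2 a : 'I_2 -> K, nonzero a & forall p : T k.+1, p \in U -> (val p).@[a] = 0.
  apply: (IHk (lower U)); first exact: mulX_lower.
    apply: contraNneq Uf => D1; apply/eqP/vspaceP => x; rewrite memvf.
    by apply: (subvP (raise_sub (mulX_lower U))); rewrite D1 raise_full memvf.
  by move: (\dim (raise U)) (\dim U) (\dim V) (\dim (lower U)) dr e dV => x y z t; lia.
exists a => // p.
have /eqP <- : raise U == V.
  rewrite -(dimv_leqif_eq (raise_sub UV)) eqn_leq dr /=.
  exact: leq_trans dV (dim_raise U0).
move/memv_addP => [_ /memv_imgP[u uU ->] [_ /memv_imgP[v vU ->] ->]].
by rewrite [val _]/= mevalD !mulXE !mevalM !az // !mul0r addr0.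
Qed.

End BasePoints.

(** * Plane curves *)

Section Numeric.
Local Open Scope nat_scope.

(** The staircase misses a triangle of side [e] of the rectangle [e.+1] by [d]. *)
Lemma sum_min_stairs e d : e <= d ->
  \sum_(k < d) minn k.+1 e.+1 + 'C(e.+1, 2) = e.+1 * d.
Proof.
elim: d => [|d IHd]; first by rewrite leqn0 => /eqP->; rewrite big_ord0.
rewrite leq_eqVlt => /predU1P[->|ed]; last first.
  by rewrite big_ord_recr /= (minn_idPr _) // mulnS -(IHd ed) addnAC addnC.
rewrite (eq_bigr (fun k : 'I_d.+1 => k.+1)) => [|k _]; last first.
  by apply/minn_idPl; have := ltn_ord k; lia.
elim: d {IHd e} => [|d IHd]; first by rewrite big_ord_recr big_ord0.
by rewrite big_ord_recr /= binS bin1; nia.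
Qed.

(* [H] is the Hilbert function of a finite set of plane points and [h] its first
   difference. With [e = h d > 0], [h] dominates [min (k + 1, e + 1)] below degree [d],
   which forces [e < a1], while the values above degree [d] sum to at most
   ['C(e, 2)]. *)
Lemma hilbert_numeric (h H : nat -> nat) d c a1 a2 : 0 < d ->
  H 0 = h 0 -> (forall k, H k.+1 = h k.+1 + H k) ->
  (forall k, h k = k.+1 \/ h k.+1 <= h k) -> (forall k, h k <= k.+1) ->
  (forall k, d <= k.+1 -> h k.+1 <= (h k).-1) ->
  H d <= c -> a1 + a2 <= d -> (a1 = 0 -> a2 < d) ->
  c + 'C(a1.-1, 2) <= a1 * d + a2 ->
  forall k, H k <= a1 * d + a2.
Proof.
move=> d0 H0 HS h1 h2 h3 Hd a12 a1z ca.
pose e := h d.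
(* From degree [d] on, [h] decreases by at least one per step until it is zero, so the later values
   are at most [e - 1, e - 2, ...]. *)
have tail j : h (d + j) <= e - j /\ H (d + j) + 'C(e - j, 2) <= H d + 'C(e, 2).
  elim: j => [|j [IH1 IH2]]; first by rewrite addn0 subn0.
  have h4 := h3 (d + j); rewrite addnS HS; split; first by lia.
  case E : (e - j) IH1 IH2 => [|i] IH1 IH2; first by rewrite (_ : e - j.+1 = 0); lia.
  rewrite (_ : e - j.+1 = i); last by lia.
  by move: IH2; rewrite binS bin1; lia.
have mono k j : H k <= H (k + j).
  by elim: j => [|j IHj]; rewrite ?addn0 ?addnS ?HS //; lia.
have bound k : H k <= H d + 'C(e, 2).
  by have [_] := tail k; have := mono k d; rewrite addnC; lia.
move=> k; apply: leq_trans (bound k) _.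
have [e0|e0] := posnP e.
  rewrite e0 bin0n /= addn0; lia.
suff ea : e < a1.
  apply: leq_trans ca; apply: leq_add => //; apply: leq_bin2l; lia.
have [q dq] : exists q, d = q.+1 by exists d.-1; lia.
(* By [h3], [h (d - 1)] exceeds [e]; descending from there, [h1] says that [h] is either maximal or
   does not fall below its next value. *)
have low : forall j, j <= q -> minn (q - j).+1 e.+1 <= h (q - j).
  have := h3 q; rewrite -dq leqnn -/e => /(_ isT) hq.
  elim=> [_|j IHj jq]; first by rewrite subn0; lia.
  have := IHj (ltnW jq); rewrite (_ : q - j = (q - j.+1).+1); last by lia.
  by case: (h1 (q - j.+1)); lia.
have Hsum j : H j = \sum_(i < j.+1) h i.
  by elim: j => [|j IHj]; rewrite big_ord_recr /= ?big_ord0 ?H0 // HS IHj addnC.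
rewrite ltnNge; apply/negP => ae.
have eq : e <= q.
  have := h3 q; rewrite -dq leqnn -/e => /(_ isT); have := h2 q; lia.
(* If [a1 <= e], the staircase below [d] and the value [e] at [d] give
   [c >= a1.+1 * d - 'C(a1.+1, 2) + a1], too much for the assumed bound on [c] as [a1 + a2 <= d];
   for [a1 = 0] the contradiction is [d <= a2]. *)
have G : \sum_(k < d) minn k.+1 a1.+1 + a1 <= c.
  apply: leq_trans Hd; rewrite Hsum big_ord_recr /=; apply: leq_add => //.
  apply: leq_sum => i _; have iq : i <= q by have := ltn_ord i; lia.
  by have := low (q - i); rewrite subKn //; lia.
have a1d : a1 <= d by lia.
have := sum_min_stairs a1d; move: (\sum_(k < d) _) G => s G.
case: a1 a12 a1z ca ae G {a1d} => [|a] a12 a1z ca ae G.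
  by have := a1z erefl; move: ca; rewrite !bin_small //; lia.
have := ca; rewrite /= binS bin1 [in X in _ -> X -> _]binS bin1; lia.
Qed.

End Numeric.

(** * The homogeneous ideal of a finite set of points *)

Section VanishingIdeal.
Variables (K : fieldType) (n N : nat) (v : 'I_N -> 'I_n.+1 -> K).

(** Vanishing at fixed representatives is required of every component, since it does not pass from a
    polynomial to its components. *)
Definition vanish (p : {mpoly K[n.+1]}) := forall k i, (pihomog mdeg k p).@[v i] = 0.

Lemma vanish_ideal : hom_ideal vanish.
Proof.
have hom d p q : q \is d.-homog -> vanish q -> vanish (p * q).
  move=> qd vq k i; rewrite (pihomog_mulr _ _ qd); case: leqP => _; last exact: meval0.
  by rewrite mevalM -[X in _ * X.@[_]](pihomog_dE qd) vq mulr0.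
have add p q : vanish p -> vanish q -> vanish (p + q).
  by move=> vp vq k i; rewrite linearD /= mevalD vp vq addr0.
have zero : vanish 0 by move=> k i; rewrite linear0 meval0.
have comp d p : vanish p -> vanish (pihomog mdeg d p).
  move=> vp k i; have [->|kd] := eqVneq d k; first by rewrite pihomog_id.
  by rewrite (pihomog_ne0 kd (pihomogP mdeg d p)) meval0.
split=> // p q vq; rewrite (@pihomog_partitionE n.+1 K mdeg _ q (leqnn _)) mulr_sumr.
by apply: (big_ind vanish) => // d _; apply: (hom d); [exact: pihomogP | exact: comp].
Qed.

Lemma vanish_homog d p : p \is d.-homog -> (forall i, p.@[v i] = 0) -> vanish p.
Proof.
move=> pd pv k i; have [<-|kd] := eqVneq d k; first by rewrite (pihomog_dE pd).
by rewrite (pihomog_ne0 kd pd) meval0.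
Qed.

Lemma vanish_eval p i : vanish p -> p.@[v i] = 0.
Proof.
move=> vp; rewrite (@pihomog_partitionE n.+1 K mdeg _ p (leqnn _)) (raddf_sum (meval _)).
by rewrite big1 // => k _; apply: vp.
Qed.

Lemma hilb_vanish d (W : {vspace dhomog n.+1 K d}) :
  (forall i (p : dhomog n.+1 K d), p \in W -> (val p).@[v i] = 0) ->
  (hilb vanish d <= 'C(d + n, d) - \dim W)%N.
Proof.
move=> Wv; rewrite /hilb dim_dhomog; apply/leq_sub2l/dimvS/subvP => p pW.
by apply/(pieceP vanish_ideal)/(vanish_homog (dhomog_is_dhomog p)) => i; apply: Wv.
Qed.

End VanishingIdeal.

Lemma vanish_regular (K : fieldType) n N (v : 'I_N -> 'I_n.+1 -> K) d l :
  l \is d.-homog -> (forall i, l.@[v i] != 0) -> regular (vanish v) l.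
Proof.
move=> ld lv u ul k i; have := ul (k + d)%N i.
rewrite (pihomog_mulr _ _ ld) leq_addl addnK mevalM => /eqP.
by rewrite mulf_eq0 (negbTE (lv i)) orbF => /eqP.
Qed.

Section PlaneCurves.
Variable K : closedFieldType.

Theorem plane_bound d N (v : 'I_N -> 'I_3 -> K) (W : {vspace dhomog 3 K d}) a1 a2 :
  (0 < d)%N -> family v ->
  (forall i (p : dhomog 3 K d), p \in W -> (val p).@[v i] = 0) ->
  (forall w, nonzero w -> (forall p : dhomog 3 K d, p \in W -> (val p).@[w] = 0) ->
     exists i, ~ indep2 (v i) w) ->
  (a1 + a2 <= d)%N -> (a1 = 0%N -> (a2 < d)%N) ->
  ('C(d + 2, d) - \dim W + 'C(a1.-1, 2) <= a1 * d + a2)%N ->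
  (N <= a1 * d + a2)%N.
Proof.
move=> d0 fv Wv Wz a12 a1z ca; pose I := vanish v; have hI : hom_ideal I := vanish_ideal v.
have [nv _] := fv; have [c cP] := avoid_hyperplane nv.
have hl := hyperplane_dhomog c.
have lv i : (hyperplane c).@[v i] != 0 by apply: (cP i) => // -[a [b]]; rewrite mulrC eqxx.
have rl : regular I (hyperplane c) := vanish_regular hl lv.
(* [J] is the restriction of the vanishing ideal to a line that avoids the points; [hilb J] is the
   first difference of [hilb I]. *)
have [J hJ eJ] := restrict_image c hI.
have hA := adjoin_ideal hI hl.
have hfJ k : hilb (adjoin I (hyperplane c)) k = hilb J k by rewrite eJ hilb_restrict.
have mulJ i k : (mulX K i k @: piece J k <= piece J k.+1)%VS.
  apply/subvP => x /memv_imgP[y /(pieceP hJ) Jy ->]; apply/(pieceP hJ).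
  by rewrite mulXE mulrC; apply: idealM.
have hJE k : (hilb J k + \dim (piece J k) = k.+1)%N by rewrite hilbE dim_binary.
apply: leq_trans (hilb_points hI fv _ (leqnSn N)) _.
  by move=> i p; apply: vanish_eval.
apply: (@hilbert_numeric (hilb J) (hilb I) d ('C(d + 2, d) - \dim W)%N a1 a2) => //.
- apply/eqP; rewrite eqn_leq -hfJ (hilb_adjoin_le 0 hI hl) andbT.
  by have := hilb_le_sum hI hl 0; rewrite big_ord_recr big_ord0.
- by move=> k; have := hilb_regular k hI hl rl; rewrite addn1 hfJ => ->.
- move=> k; have [U0|/dim_raise lt] := eqVneq (piece J k) 0%VS.
    by left; have := hJE k; rewrite U0 dimv0 addn0.
  right; have := dimvS (raise_sub (fun i => mulJ i k)).
  move=> le; have := leq_trans lt le; have := hJE k; have := hJE k.+1.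
  by move: (hilb _ _) (hilb _ _) (\dim _) (\dim _) => x y z t; lia.
- by move=> k; have := hJE k; move: (hilb _ _) (\dim _) => x y; lia.
(* If [hilb J] did not decrease, [common_zero] would give a point [a] of the line at which [J]
   vanishes in degree [k.+1]. Then [W] vanishes there as well, although the line avoids all its
   zeros. *)
- move=> k dk; have [U1|Uf] := eqVneq (piece J k) fullv.
    have := dimvS (raise_sub (fun i => mulJ i k)); rewrite U1 raise_full dim_binary.
    by have := hJE k.+1; move: (hilb _ _) (hilb _ _) (\dim _) => x y z; lia.
  rewrite leqNgt; apply/negP => lt.
  have [|a a0 az] := common_zero (fun i => mulJ i k) Uf.
    have := hJE k; have := hJE k.+1; move: lt.
    by move: (hilb _ _) (hilb _ _) (\dim _) (\dim _) => x y z t; lia.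
  have Wa (p : dhomog 3 K d) : p \in W -> (restrict c (val p)).@[a] = 0.
    move=> pW; have [i ai] := a0.
    have Jp : J (restrict c (val p)).
      have : adjoin I (hyperplane c) (val p).
        by apply/sub_adjoin/(vanish_homog (dhomog_is_dhomog p)) => j; apply: Wv.
      by rewrite eJ.
    (* A power of a variable that is nonzero at [a] lifts the form from degree [d] to degree
       [k.+1]. *)
    have hp : restrict c (val p) * 'X_i ^+ (k.+1 - d) \is k.+1.-homog.
      have := dhomogM (restrict_dhomog c (dhomog_is_dhomog p))
        (dhomogMn (k.+1 - d) (@dhomog_var K _ i)).
      by rewrite mul1n subnKC.
    have : hproj k.+1 (restrict c (val p) * 'X_i ^+ (k.+1 - d)) \in piece J k.+1.
      by apply/(pieceP hJ); rewrite hprojE // mulrC; apply: idealM.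
    move/az; rewrite hprojE // mevalM rmorphXn /= mevalXU => /eqP.
    by rewrite mulf_eq0 expf_eq0 (negbTE ai) andbF orbF => /eqP.
  have w0 : nonzero (extend a (\sum_j c j * a j)).
    by have [j aj] := a0; exists (widen_ord (leqnSn _) j); rewrite extend_widen.
  have [p pW|i /(cP i _ w0)/negP[]] := Wz _ w0 _; first by rewrite -restrict_eval Wa.
  by rewrite -restrict_eval restrict_hyperplane meval0.
- exact: hilb_vanish.
Qed.

End PlaneCurves.

(** * Lexicographic order and base-d values *)

Section Digits.
Local Open Scope nat_scope.
Variable d : nat.

(** The most significant digit comes first. Digits are not bounded, since the first entry of an
    element of [Omega'] may be [d]. *)
Definition base_value m (b : 'I_m -> nat) : nat := \sum_(i < m) b i * d ^ (m - i.+1).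

Lemma base_valueS m (b : 'I_m.+1 -> nat) :
  base_value b = b ord0 * d ^ m + base_value (fun i => b (lift ord0 i)).
Proof. by rewrite /base_value big_ord_recl /= subn1. Qed.

Lemma base_value_bound m (b : 'I_m -> nat) : (forall i, b i < d) -> base_value b < d ^ m.
Proof.
elim: m b => [|m IHm] b bd; first by rewrite /base_value big_ord0.
rewrite base_valueS expnS; have := IHm (fun i => b (lift ord0 i)) (fun i => bd _).
have := bd ord0; move: (base_value _) (b ord0) (d ^ m) => x y z; nia.
Qed.

(** The digits of [b] after position [k], being smaller than [d], add up to less than one unit at
    position [k]. *)
Lemma base_value_lex m (b b' : 'I_m -> nat) (k : 'I_m) :
  (forall i : 'I_m, i < k -> b i = b' i) -> b k < b' k ->
  (forall i : 'I_m, k < i -> b i < d) -> base_value b < base_value b'.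
Proof.
elim: m b b' k => [|m IHm] b b' k; first by case: k.
case: (unliftP ord0 k) => [j|] -> eb lt bd; rewrite !base_valueS.
  rewrite (eb ord0) // ltn_add2l; apply: (IHm _ _ j) => // i ij.
    by apply: eb; rewrite /= /bump /=; lia.
  by apply: bd; rewrite /= /bump /=; lia.
have := @base_value_bound m (fun i => b (lift ord0 i)) (fun i => bd (lift ord0 i) isT).
have : (b ord0).+1 * d ^ m <= b' ord0 * d ^ m by rewrite leq_mul2r lt orbT.
rewrite mulSn; move: (base_value _) (base_value _) (_ * _) (_ * _) => x y z t; lia.
Qed.

Lemma base_value_le m (b b' : 'I_m -> nat) :
  (forall i, b i <= b' i) -> base_value b <= base_value b'.
Proof. by move=> le; apply: leq_sum => i _; rewrite leq_mul2r le orbT. Qed.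

Lemma first_diff m (b b' : 'I_m -> nat) :
  (forall i, b i = b' i) \/ exists2 k : 'I_m, forall i : 'I_m, i < k -> b i = b' i & b k != b' k.
Proof.
case: (pickP (fun k => b k != b' k)) => [k0 k0P|no]; last first.
  by left=> i; apply/eqP/negbFE/no.
right; case: (@arg_minnP _ k0 (fun k => b k != b' k) (fun k => k : nat) k0P) => k kP kmin.
exists k => // i ik; apply/eqP; apply/negP => /negP /kmin; lia.
Qed.

Lemma base_value_inj m (b b' : 'I_m -> nat) : (forall i, b i < d) -> (forall i, b' i < d) ->
  base_value b = base_value b' -> forall i, b i = b' i.
Proof.
move=> bd bd' e; case: (first_diff b b') => [//|[k eb]].
have eb' (i : 'I_m) : i < k -> b' i = b i by move=> /eb.
rewrite neq_ltn => /orP[lt|lt].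
  by have := base_value_lex eb lt (fun i _ => bd i); rewrite e ltnn.
by have := base_value_lex eb' lt (fun i _ => bd' i); rewrite e ltnn.
Qed.

Lemma card_base_value_lt m x : x <= d ^ m ->
  #|[set g : {ffun 'I_m -> 'I_d} | base_value (fun k => g k) < x]| = x.
Proof.
move=> xd; pose h (g : {ffun 'I_m -> 'I_d}) := Ordinal (base_value_bound (fun k => ltn_ord (g k))).
have h_inj : injective h.
  move=> g g' /(congr1 val) /= e; apply/ffunP => k; apply/val_inj.
  exact: (base_value_inj (fun k => ltn_ord (g k)) (fun k => ltn_ord (g' k)) e).
have h_bij : bijective h by apply: inj_card_bij; rewrite // card_ffun !card_ord.
rewrite (_ : [set g | _] = h @^-1: [set widen_ord xd j | j in 'I_x]); last first.
  apply/setP => g; rewrite !inE; apply/idP/imsetP => [lt|[j _ /(congr1 val) /= ->] //].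
  by exists (Ordinal lt) => //; apply/val_inj.
rewrite on_card_preimset ?card_imset ?card_ord //; last exact: onW_bij.
by move=> i j /(congr1 val) /= /val_inj.
Qed.

End Digits.

Section Lex.
Local Open Scope nat_scope.
Variables (d m : nat).
Local Notation tup := (m.+1.-tuple 'I_d.+1).
Local Notation wid := (widen_ord (leqnSn m)).
Implicit Types a b : tup.

Definition lexlt a b : bool := ((a : m.+1.-tuplelexi 'I_d.+1) < b)%O.

Lemma lexltP a b : reflect
  (exists2 k : 'I_m.+1, forall i : 'I_m.+1, i < k -> tnth a i = tnth b i & tnth a k < tnth b k)
  (lexlt a b).
Proof. exact: Order.TupleLexiOrder.ltxi_tuplePlt. Qed.

Lemma lexlt_irr a : lexlt a a = false. Proof. exact: (@ltxx _ (m.+1.-tuplelexi 'I_d.+1) a). Qed.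

Lemma lexlt_total a b : a != b -> lexlt a b || lexlt b a.
Proof. exact: (@lt_total _ (m.+1.-tuplelexi 'I_d.+1) a b). Qed.

Lemma lexlt_trans a b c : lexlt a b -> lexlt b c -> lexlt a c.
Proof. exact: (@lt_trans _ (m.+1.-tuplelexi 'I_d.+1) b a c). Qed.

(** The list is sorted decreasingly without repetition, so the elements above the entry of index
    [r.-1] are exactly its first [r.-1] entries. *)
Lemma omega'P r : 0 < r <= #|Omega' d m| ->
  omega' r d m \in Omega' d m /\
  #|[set b in Omega' d m | lexlt (omega' r d m) b]| = r.-1.
Proof.
move=> /andP[r0 rle]; rewrite /omega'.
set s := sort _ _; set x0 := [tuple of nseq _ _]; set a := nth x0 s r.-1.
have su : uniq s by rewrite sort_uniq enum_uniq.
have ms : s =i Omega' d m by move=> b; rewrite mem_sort mem_enum.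
have ss : size s = #|Omega' d m| by rewrite size_sort -cardE.
have rs : r.-1 < size s by rewrite ss prednK.
have as_ : a \in Omega' d m by rewrite -ms mem_nth.
split=> //.
have so : sorted (fun a b : m.+1.-tuplelexi 'I_d.+1 => (b <= a)%O) s.
  by apply: sort_sorted => x y; apply: le_total.
have tr : transitive (fun a b : m.+1.-tuplelexi 'I_d.+1 => (b <= a)%O).
  by move=> y x z /= xy yz; apply: le_trans yz xy.
have rf : reflexive (fun a b : m.+1.-tuplelexi 'I_d.+1 => (b <= a)%O).
  by move=> x /=; apply: lexx.
rewrite -(size_takel (ltnW rs)) -[RHS](card_uniqP (take_uniq r.-1 su)).
apply: eq_card => b; rewrite inE -ms; apply/idP/idP.
  move=> /andP[bs ab]; rewrite -(nth_index x0 bs) in ab *.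
  have ib : index b s < size s by rewrite index_mem.
  case: (ltnP (index b s) r.-1) => [lt|le].
    by rewrite -(nth_take x0 lt) mem_nth // size_takel // ltnW.
  have := sorted_leq_nth tr rf x0 so _ _ rs ib le.
  move=> /= ba; move: ab; rewrite /lexlt lt_neqAle => /andP[/eqP ne ab].
  by case: ne; apply/eqP; rewrite eq_le ab ba.
move=> bt; have bs := mem_take bt; rewrite bs /= /lexlt lt_neqAle.
have lt : index b s < r.-1.
  move: (bt); rewrite -index_mem size_takel ?(ltnW rs) //.
  by rewrite -{2}[s](cat_take_drop r.-1) index_cat bt.
rewrite -[b](nth_index x0 bs); apply/andP; split; last first.
  by apply: (sorted_leq_nth tr rf x0 so) (ltnW lt); rewrite inE // index_mem.
by rewrite nth_uniq ?index_mem // gtn_eqF.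
Qed.

Lemma Omega'P a : reflect
  (\sum_(i < m.+1) tnth a i = d /\ forall i : 'I_m.+1, 0 < i < m -> tnth a i <> d :> nat)
  (a \in Omega' d m).
Proof.
rewrite inE; apply: (iffP andP) => [[/eqP sa /forallP H]|[sa H]]; split=> //.
- by move=> i im; apply/eqP; move: (H i); rewrite im.
- exact/eqP.
- by apply/forallP => i; apply/implyP => im; apply/eqP; apply: H.
Qed.

Definition digits a (i : 'I_m) : nat := tnth a (wid i).

Lemma sum_digits a : \sum_(i < m.+1) tnth a i = \sum_(i < m) digits a i + tnth a ord_max.
Proof. by rewrite big_ord_recr. Qed.

Lemma Omega'_digit_lt a (i : 'I_m) : 0 < i -> a \in Omega' d m -> digits a i < d.
Proof.
move=> i0 /Omega'P[sa H]; rewrite ltn_neqAle; apply/andP; split.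
  by apply/eqP; apply: H; rewrite /= i0 /=.
by rewrite -ltnS ltn_ord.
Qed.

(* The last entry is determined by the others, so the first difference of two
   exponents of equal degree occurs before it. *)
Lemma lexlt_digits a b : \sum_(i < m.+1) tnth a i = \sum_(i < m.+1) tnth b i -> lexlt a b ->
  exists2 k : 'I_m, forall i : 'I_m, i < k -> digits a i = digits b i & digits a k < digits b k.
Proof.
move=> sab /lexltP[k eab lt]; case: (ltnP k m) => [km|mk].
  have kE : k = wid (Ordinal km) by apply/val_inj.
  exists (Ordinal km); last by rewrite /digits -kE.
  by move=> i ik; rewrite /digits eab.
have kE : k = ord_max by apply/val_inj => /=; have := ltn_ord k; lia.
move: sab; rewrite !sum_digits (eq_bigr (digits b)) => [/eqP|i _]; last first.
  by rewrite /digits eab // kE /=.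
by rewrite eqn_add2l -kE => /eqP e; move: lt; rewrite e ltnn.
Qed.

Lemma digits_inj a b : \sum_(i < m.+1) tnth a i = \sum_(i < m.+1) tnth b i ->
  digits a =1 digits b -> a = b.
Proof.
move=> sab e; apply/eqP; apply/negP => /negP /lexlt_total /orP[|] /lexlt_digits H.
  by have [k _] := H sab; rewrite e ltnn.
by have [k _] := H (esym sab); rewrite e ltnn.
Qed.

Lemma base_value_Omega' a b : a \in Omega' d m -> b \in Omega' d m -> lexlt a b ->
  base_value d (digits a) < base_value d (digits b).
Proof.
move=> aO bO ab; have [[sa _] [sb _]] := (Omega'P _ aO, Omega'P _ bO).
have [k eab lt] := lexlt_digits (etrans sa (esym sb)) ab.
by apply: base_value_lex eab lt _ => i ki; apply: Omega'_digit_lt => //; lia.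
Qed.

(** Either the first digit is [d] and the others vanish, or all digits are smaller than [d]. *)
Lemma base_value_Omega'_le a : 0 < m -> a \in Omega' d m -> base_value d (digits a) <= d ^ m.
Proof.
move=> m0 aO; have [sa _] := Omega'P _ aO; pose i0 := Ordinal m0.
have [a0|a0] := eqVneq (digits a i0) d.
  have z (i : 'I_m) : i != i0 -> digits a i = 0.
    move=> ii; move: sa; rewrite sum_digits (bigD1 i0) //= (bigD1 i) //= a0; lia.
  rewrite /base_value (bigD1 i0) //= big1 => [|i /z-> //].
  by rewrite addn0 a0 -expnS subn1 prednK.
apply/ltnW/base_value_bound => i; have [-> |] := eqVneq i i0.
  by rewrite ltn_neqAle a0 -ltnS ltn_ord.
move=> ii; apply: Omega'_digit_lt => //; rewrite lt0n.
by apply: contra ii => /eqP e; apply/eqP/val_inj.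
Qed.

(** [base_value] is strictly increasing on [Omega'], so the elements below [a] have distinct values
    below that of [a]. *)
Lemma card_below a : a \in Omega' d m ->
  #|[set b in Omega' d m | lexlt b a]| <= base_value d (digits a).
Proof.
move=> aO; set A := [set _ in _ | _].
(* The codomain has one element too many, which makes [inord] available; [ord_max] is shown not to
   be attained. *)
pose f b : 'I_(base_value d (digits a)).+1 := inord (base_value d (digits b)).
have fE b : b \in A -> f b = base_value d (digits b) :> nat.
  by rewrite inE => /andP[bO ba]; rewrite inordK // ltnS ltnW // base_value_Omega'.
have fi : {in A &, injective f}.
  move=> b c bA cA /(congr1 val); rewrite /= !fE // => e.
  have [bO cO] : b \in Omega' d m /\ c \in Omega' d m.
    by move: bA cA; rewrite !in_set => /andP[-> _] /andP[-> _].
  apply/eqP; apply/negP => /negP /lexlt_total /orP[] bc.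
    by have := base_value_Omega' bO cO bc; rewrite e ltnn.
  by have := base_value_Omega' cO bO bc; rewrite e ltnn.
rewrite -(card_in_imset fi) -ltnS -[X in _ < X]card_ord.
rewrite -cardsT; apply: proper_card; rewrite properE subsetT /=.
apply/negP => /subsetP/(_ ord_max); rewrite inE => /(_ isT)/imsetP[b bA].
move/(congr1 val); rewrite /= fE // => e.
by move: bA; rewrite inE => /andP[bO /(base_value_Omega' bO aO)]; rewrite -e ltnn.
Qed.

Definition pure (i : 'I_m.+1) : tup := [tuple if j == i then ord_max else ord0 | j < m.+1].

Lemma pureE i j : tnth (pure i) j = (if j == i then d else 0) :> nat.
Proof. by rewrite tnth_mktuple; case: ifP. Qed.

Lemma sum_pure i : \sum_(j < m.+1) tnth (pure i) j = d.
Proof.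
rewrite (bigD1 i) //= pureE eqxx big1 ?addn0 // => j ji.
by rewrite pureE (negbTE ji).
Qed.

(** With indices starting at zero, these are the exponents [d e_2, ..., d e_m] excluded from
    [Omega']. *)
Definition middle : {set tup} := [set pure i | i in [set i : 'I_m.+1 | 0 < i < m]].

Lemma card_middle : 0 < d -> #|middle| = m.-1.
Proof.
move=> d0; rewrite card_imset => [|i j e]; last first.
  apply/eqP; apply: contraTT isT => ij.
  by have := pureE j i; rewrite -e pureE eqxx (negbTE ij) => e0; rewrite e0 in d0.
case: m => [|n]; first by apply: eq_card0 => i; rewrite !inE ltn0 andbF.
rewrite -sum1dep_card big_mkcond big_ord_recl /= add0n big_ord_recr /= ltnn addn0.
rewrite (eq_bigr (fun=> 1)) ?sum1_card ?card_ord // => i _.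
by rewrite /= /bump /= add1n ltnS ltn_ord.
Qed.

Lemma sum_middle b : b \in middle -> \sum_(j < m.+1) tnth b j = d.
Proof. by case/imsetP => i _ ->; apply: sum_pure. Qed.

Lemma Omega'_compl : Omega' d m = [set b : tup | \sum_(j < m.+1) tnth b j == d] :\: middle.
Proof.
apply/setP => b; rewrite !inE andbC; case: eqP => sb; rewrite ?andbF //= !andbT.
apply/idP/idP => [/forallP H|/imsetP H].
  apply/imsetP => -[i]; rewrite inE => im e; have := H i.
  by rewrite im e pureE eqxx /= eqxx.
apply/forallP => i; apply/implyP => im; apply/eqP => bi; apply: H.
exists i; first by rewrite inE.
apply/eq_from_tnth => j; apply/val_inj; rewrite /= pureE.
case: eqP => [->//|/eqP ji]; move: sb.
by rewrite (bigD1 i) //= bi (bigD1 j) //=; lia.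
Qed.

Lemma card_degree : #|[set b : tup | \sum_(j < m.+1) tnth b j == d]| = 'C(d + m, m).
Proof.
rewrite addnC -(card_ord_partitions m d); apply: eq_card => b; rewrite !inE.
by rewrite big_tuple.
Qed.

Lemma card_Omega' : 0 < d -> #|Omega' d m| = 'C(d + m, m) - m.-1.
Proof.
move=> d0; rewrite Omega'_compl cardsD (setIidPr _) ?card_degree ?card_middle //.
by apply/subsetP => b /sum_middle sb; rewrite inE sb.
Qed.

End Lex.

(** * Counting exponents for [m = 2] *)

Section Plane.
Local Open Scope nat_scope.
Variable d : nat.

Lemma card_ord_below n x (P : pred 'I_n) : (forall j, P j -> j < x) -> \sum_(j < n | P j) 1 <= x.
Proof.
move=> Px; rewrite sum1dep_card.
have f (j : 'I_n) : P j -> j < x by apply: Px.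
case: x Px f => [|x] Px f.
  by rewrite leqn0 cards_eq0; apply/eqP/setP => j; rewrite !inE; apply/negP => /f.
have fi : {in [set j | P j] &, injective (fun j : 'I_n => inord j : 'I_x.+1)}.
  move=> i j; rewrite !inE => /f ix /f jx /(congr1 val) /=; rewrite !inordK // => e.
  exact/val_inj.
by rewrite -(card_in_imset fi) -[X in _ <= X]card_ord max_card.
Qed.

Lemma base_value2 (b : 'I_2 -> nat) : base_value d b = b ord0 * d + b ord_max.
Proof.
rewrite /base_value big_ord_recr big_ord_recr big_ord0 /= add0n expn1 expn0 muln1.
by congr (b _ * _ + _); apply/val_inj.
Qed.

(** This sharpens [card_below]: the degree leaves fewer than [d] second entries once the first is at
    least [2]. The total loss is the binomial term that [hilbert_numeric] expects. *)
Lemma card_below_plane (a : 3.-tuple 'I_d.+1) : a \in Omega' d 2 ->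
  #|[set b in Omega' d 2 | lexlt b a]| + 'C((digits a ord0).-1, 2)
  <= digits a ord0 * d + digits a ord_max.
Proof.
move=> aO; set a0 := digits a ord0; set a1 := digits a ord_max.
have [sa _] := Omega'P _ aO.
have a0d : a0 <= d by rewrite -ltnS ltn_ord.
(* [g i] bounds the number of second entries for the first entry [i]. If [i < a0] they run from [0]
   to [d - i] with [d] excluded; if [i = a0] they are below [a1]. *)
pose g i := if i < a0 then minn d (d.+1 - i) else if i == a0 then a1 else 0.
have G1 n : n <= a0 -> \sum_(i < n) g i + 'C(n.-1, 2) = n * d.
  elim: n => [|n IHn] na; first by rewrite big_ord0.
  rewrite big_ord_recr /= mulSn -(IHn (ltnW na)) /g na.
  case: n na {IHn} => [|n] na; first by rewrite big_ord0 /=; lia.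
  by rewrite /= binS bin1; lia.
have G2 n : \sum_(i < (a0 + n).+1) g i = \sum_(i < a0) g i + a1.
  elim: n => [|n IHn]; rewrite big_ord_recr /=; first by rewrite addn0 /g ltnn eqxx.
  rewrite addnS IHn /g; case: ifP => [|_]; first by lia.
  by case: eqP => [|_]; [lia | rewrite addn0].
apply: (@leq_trans (\sum_(i < d.+1) g i + 'C(a0.-1, 2))); last first.
  by rewrite -(subnKC a0d) G2 subnKC // addnAC G1.
rewrite leq_add2r.
pose f (b : 3.-tuple 'I_d.+1) :=
  (tnth b (widen_ord (leqnSn 2) ord0), tnth b (widen_ord (leqnSn 2) ord_max)).
have fi : {in [set b in Omega' d 2 | lexlt b a] &, injective f}.
  move=> b c; rewrite !inE -![_ && [forall _, _]]/(_ && [forall _, _]).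
  move=> /andP[/andP[/eqP sb _] _] /andP[/andP[/eqP sc _] _] [e0 e1].
  apply: digits_inj; first by rewrite sb sc.
  move=> i; rewrite /digits; case: (unliftP ord_max i) => [j|] ->.
    by rewrite (_ : lift _ _ = ord0) ?e0 //; apply/val_inj; rewrite ord1.
  by rewrite e1.
rewrite -(card_in_imset fi).
pose P (i j : 'I_d.+1) :=
  [&& i + j <= d, j != d :> nat & (i < a0) || ((i == a0 :> nat) && (j < a1))].
apply: (@leq_trans #|[set x | P x.1 x.2]|).
  apply: subset_leq_card; apply/subsetP => _ /imsetP[b + ->].
  rewrite [in X in X -> _]inE => /andP[bO ba].
  have [sb nb] := Omega'P _ bO; rewrite inE /P /=.
  have [k eb lt] := lexlt_digits (etrans sb (esym sa)) ba.
  have sb' : digits b ord0 + digits b ord_max + tnth b ord_max = d.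
    rewrite -[RHS]sb sum_digits big_ord_recr big_ord_recr big_ord0 /= add0n.
    congr (digits b _ + _ + _).
    exact/val_inj.
  rewrite -/(digits b ord0) -/(digits b ord_max); apply/and3P; split; first by lia.
    by apply/eqP; apply: nb.
  case: (unliftP ord_max k) eb lt => [j|] -> eb lt.
    have e0 : lift ord_max j = ord0 :> 'I_2 by apply/val_inj; rewrite ord1.
    by rewrite /a0 -e0 lt.
  by rewrite /a1 /a0 lt andbT (eb ord0) // eqxx orbT.
rewrite -sum1dep_card -(pair_big_dep predT P (fun _ _ => 1)) /=.
apply: leq_sum => i _; rewrite /g; case: ifP => [ia|nia].
  by apply: card_ord_below => j /and3P[le ne _]; have := ltn_ord j; move/eqP: ne; lia.
case: eqP => [e|ne].
  by apply: card_ord_below => j /and3P[_ _]; rewrite nia => /andP[].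
rewrite leqn0 big_pred0 // => j; apply/negbTE/negP => /and3P[_ _].
by rewrite nia => /andP[/eqP].
Qed.

End Plane.

(** * The extremal linear systems *)

Section ProjectivePoints.
Variables (K : fieldType) (m : nat).
Implicit Types (P : proj_space K m) (w : 'I_m.+1 -> K).

Definition row_of w : 'rV[K]_m.+1 := \row_i w i.
Definition coords P : 'I_m.+1 -> K := fun i => vpick (val P) 0 i.

Lemma vpick_neq0 P : vpick (val P) != 0.
Proof. by rewrite vpick0 -dimv_eq0 (eqP (valP P)). Qed.

Lemma coords_nonzero P : nonzero (coords P).
Proof.
apply: NNPP => no; case/eqP: (vpick_neq0 P); apply/rowP => i; rewrite mxE.
by apply/eqP/negP => /negP ne; apply: no; exists i.
Qed.

Lemma row_coords P : row_of (coords P) = vpick (val P).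
Proof. by apply/rowP => i; rewrite mxE. Qed.

Lemma val_coords P : val P = <[row_of (coords P)]>%VS.
Proof.
apply/eqP; rewrite row_coords eq_sym eqEdim -memvE memv_pick dim_vline vpick_neq0.
by rewrite (eqP (valP P)).
Qed.

Lemma row_of_scale w w' t : t != 0 -> (forall i, w' i = t * w i) ->
  <[row_of w']>%VS = <[row_of w]>%VS.
Proof.
move=> t0 e; have -> : row_of w' = t *: row_of w by apply/rowP => i; rewrite !mxE e.
apply/eqP; rewrite eqEsubv -!memvE memvZ ?memv_line //=.
by rewrite -{1}[row_of w](scalerK t0) memvZ ?memv_line.
Qed.

Lemma coords_indep P Q : P != Q -> indep2 (coords P) (coords Q).
Proof.
move=> PQ; apply: NNPP => ni; case/eqP: PQ; apply/val_inj.
have [t t0 e] := not_indep2 (coords_nonzero P) (coords_nonzero Q) ni.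
by rewrite !val_coords (row_of_scale t0 e).
Qed.

Lemma zero_locusE d (W : {vspace hpoly K d m}) P w : val P = <[row_of w]>%VS ->
  in_zero_locus W P <-> (forall p : hpoly K d m, p \in W -> (val p).@[w] = 0).
Proof.
move=> Pw; split=> [H p pW|H p pW v].
  have := H p pW (row_of w); rewrite Pw memv_line => /(_ isT) <-.
  by apply: meval_eq => i; rewrite mxE.
rewrite Pw => /vlineP[t ->].
have -> : (p : {mpoly K[m.+1]}).@[fun i => (t *: row_of w) 0 i] = (val p).@[fun i => t * w i].
  by apply: meval_eq => i; rewrite !mxE.
by rewrite (meval_scale _ _ (dhomog_is_dhomog p)) H ?mulr0.
Qed.

Lemma dim_row w : nonzero w -> \dim <[row_of w]> == 1%N.
Proof.
move=> [i wi]; rewrite dim_vline eqb1; apply: contraNneq wi => /rowP/(_ i).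
by rewrite !mxE => ->.
Qed.

End ProjectivePoints.

Lemma distinct_elements (K : closedFieldType) N :
  exists a : nat -> K, forall i j, (i < N)%N -> (j < N)%N -> a i = a j -> i = j.
Proof.
suff [s sN su] : exists2 s : seq K, size s = N & uniq s.
  exists (nth 0 s) => i j iN jN e; apply/eqP.
  by rewrite -(nth_uniq 0 _ _ su) ?sN // e.
elim: N => [|N [s sN su]]; first by exists [::].
have /closed_nonrootP[x xs] : \prod_(y <- s) ('X - y%:P) != 0 :> {poly K}.
  by apply/monic_neq0/monic_prod => y _; apply: monicXsubC.
exists (x :: s); rewrite /= ?sN // su andbT.
by move: xs; rewrite root_prod_XsubC.
Qed.

Section Construction.
Variables (K : closedFieldType) (d m : nat) (a : nat -> K).
Hypothesis a_inj : forall i j, (i < d.+1)%N -> (j < d.+1)%N -> a i = a j -> i = j.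
Local Notation tup := (m.+1.-tuple 'I_d.+1).
Local Notation wid := (widen_ord (leqnSn m)).

Implicit Types b c : tup.

Definition grid_form b : {mpoly K[m.+1]} :=
  (\prod_(k < m) \prod_(j < digits b k) ('X_(wid k) - a j *: 'X_ord_max))
  * 'X_ord_max ^+ tnth b ord_max.

Definition grid_point (g : 'I_m -> nat) : 'I_m.+1 -> K := extend (fun k => a (g k)) 1.

Lemma grid_form_dhomog b : (\sum_(i < m.+1) tnth b i)%N = d -> grid_form b \is d.-homog.
Proof.
move=> sb; have H : (\sum_(k < m) digits b k + 1 * tnth b ord_max)%N = d.
  by rewrite mul1n -sum_digits.
rewrite -[X in X.-homog]H; apply: dhomogM; last exact/dhomogMn/dhomog_var.
apply: dhomog_prodr => k _.
rewrite -[X in X.-homog](card_ord (digits b k)) -sum1_card; apply: dhomog_prodr => j _.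
by apply: rpredB; [|apply: dhomogZ]; apply: dhomog_var.
Qed.

Lemma grid_form_eval b (w : 'I_m.+1 -> K) : (grid_form b).@[w] =
  (\prod_(k < m) \prod_(j < digits b k) (w (wid k) - a j * w ord_max))
  * w ord_max ^+ tnth b ord_max.
Proof.
rewrite mevalM rmorphXn /= mevalXU; congr (_ * _).
rewrite rmorph_prod; apply: eq_bigr => k _; rewrite rmorph_prod; apply: eq_bigr => j _.
by rewrite /= mevalB mevalZ !mevalXU.
Qed.

Lemma grid_form_neq0 b (g : 'I_m -> nat) : (forall k, g k <= d)%N ->
  reflect (forall k, digits b k <= g k)%N ((grid_form b).@[grid_point g] != 0).
Proof.
move=> gd; rewrite grid_form_eval /grid_point extend_max expr1n mulr1.
apply: (iffP (prodf_neq0 _ _)) => H k.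
  rewrite leqNgt; apply/negP => lt; have /prodf_neq0 /(_ (Ordinal lt) isT) := H k isT.
  by rewrite extend_widen mulr1 subrr eqxx.
move=> _; apply/prodf_neq0 => j _; rewrite extend_widen mulr1 subr_eq0.
apply/eqP => /a_inj e; have := e _ _; have := H k; have := gd k; have := ltn_ord j.
by move=> h1 h2 h3 h4; have := h4 _ _; lia.
Qed.

Definition grid_hpoly b : hpoly K d m := hproj d (grid_form b).

Lemma digits_le b k : (digits b k <= d)%N.
Proof. by rewrite -ltnS ltn_ord. Qed.

(* Forms of lexicographically larger exponents vanish at the grid point of [b],
   while the form of [b] does not. *)
Lemma grid_free (s : seq tup) : sorted (@lexlt d m) s ->
  (forall b : tup, b \in s -> (\sum_(i < m.+1) tnth b i)%N = d) ->
  free (map grid_hpoly s).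
Proof.
have tr : transitive (@lexlt d m) by move=> y x z; apply: lexlt_trans.
elim: s => [|b s IHs] /= so sd; first by rewrite nil_free.
have sb : (\sum_(i < m.+1) tnth b i)%N = d by apply: sd; rewrite inE eqxx.
rewrite free_cons IHs ?(path_sorted so) //; last by move=> c cs; apply: sd; rewrite inE cs orbT.
rewrite andbT; pose pt := grid_point (digits b).
have sub : (<<map grid_hpoly s>> <= piece (vanish (fun _ : 'I_1 => pt)) d)%VS.
  apply/span_subvP => _ /mapP[c cs ->]; apply/(pieceP (vanish_ideal _)).
  have sc : (\sum_(i < m.+1) tnth c i)%N = d by apply: sd; rewrite inE cs orbT.
  have fc := grid_form_dhomog sc.
  rewrite hprojE //; apply: (vanish_homog fc) => _.
  have bc : lexlt b c := allP (order_path_min tr so) c cs.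
  have [k _ lt] := lexlt_digits (etrans sb (esym sc)) bc.
  apply/eqP; apply/negP => /negP /(grid_form_neq0 c (digits_le b)) /(_ k).
  by rewrite leqNgt lt.
apply/negP => /(subvP sub) /(pieceP (vanish_ideal _)) /(vanish_eval ord0) /eqP.
rewrite hprojE; last exact: grid_form_dhomog.
by apply/negP/(grid_form_neq0 b (digits_le b)).
Qed.

End Construction.

Section Exponents.
Variables (d m : nat).
Local Notation tup := (m.+1.-tuple 'I_d.+1).
Implicit Types a b : tup.
Local Open Scope nat_scope.

Lemma card_atleast a : a \in Omega' d m ->
  #|[set b in Omega' d m | ~~ lexlt b a]| = #|[set b in Omega' d m | lexlt a b]|.+1.
Proof.
move=> aO; rewrite (_ : [set b in _ | ~~ _] = a |: [set b in Omega' d m | lexlt a b]).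
  by rewrite cardsU1 inE lexlt_irr andbF.
apply/setP => b; rewrite in_setU1 in_set [X in _ || X]in_set.
have [->|ba] := eqVneq b a; first by rewrite lexlt_irr andbT aO.
congr (_ && _); apply/idP/idP => [nba|ab].
  by have := lexlt_total ba; rewrite (negbTE nba).
by apply/negP => /(lexlt_trans ab); rewrite lexlt_irr.
Qed.

(** If [g] first exceeds [a] at [k], the exponent [b] keeps the entries of [a] before [k], raises
    entry [k] by one and moves the rest of the degree to the last entry, which is not a digit. When
    [a] has nothing after [k] to take that one from, [a] itself serves. *)
Lemma exponent_below a (g : 'I_m -> nat) : a \in Omega' d m -> (forall i, g i < d) ->
  base_value d (digits a) <= base_value d g ->
  exists2 b, b \in Omega' d m & ~~ lexlt b a /\ forall i, digits b i <= g i.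
Proof.
move=> aO gd le; have [sa na] := Omega'P _ aO.
case: (first_diff (digits a) g) => [e|[k eg]].
  by exists a => //; rewrite lexlt_irr; split=> // i; rewrite e.
rewrite neq_ltn => /orP[lt|lt]; last first.
  have eg' (i : 'I_m) : i < k -> g i = digits a i by move=> /eg.
  by have := base_value_lex eg' lt (fun i _ => gd i); rewrite ltnNge le.
have sk : \sum_(i < m.+1 | i <= k) tnth a i + \sum_(i < m.+1 | k < i) tnth a i = d.
  rewrite -[RHS]sa [RHS](bigID (fun i : 'I_m.+1 => i <= k)) /=; congr (_ + _).
  by apply: eq_bigl => i; rewrite ltnNge.
have [s0|s0] := posnP (\sum_(i < m.+1 | k < i) tnth a i).
  exists a => //; rewrite lexlt_irr; split=> // i.
  case: (ltngtP i k) => [/eg-> //|ki|/val_inj->]; last exact: ltnW.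
  move/eqP: s0; rewrite sum_nat_eq0 => /forallP/(_ (widen_ord (leqnSn m) i)).
  by rewrite /= ki /= /digits => /eqP->.
pose f (i : 'I_m.+1) : nat := if i < k then tnth a i : nat else if i == k :> nat then (tnth a i).+1
  else if i == m :> nat then (\sum_(i < m.+1 | k < i) tnth a i).-1 else 0.
have km : k < m := ltn_ord k.
have fsum : \sum_(i < m.+1) f i = d.
  rewrite -[RHS]sk (bigID (fun i : 'I_m.+1 => i <= k)) /=.
  rewrite [X in X + _ = _](bigD1 (widen_ord (leqnSn m) k)) //=.
  rewrite [X in _ = X + _](bigD1 (widen_ord (leqnSn m) k)) //=.
  rewrite [X in _ + X = _](bigD1 ord_max) /= -?ltnNge //.
  rewrite [X in _ + (_ + X) = _]big1 => [|i /andP[ki im]]; last first.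
    rewrite /f ltnNge (ltnW _) ?ltnNge //= (gtn_eqF _) ?ltnNge //.
    by rewrite -(inj_eq val_inj) /= in im; rewrite (negbTE im).
  rewrite addn0 {1}/f ltnn eqxx {2}/f ltnNge (ltnW km) (gtn_eqF km) /= eqxx.
  rewrite (eq_bigr (fun i : 'I_m.+1 => tnth a i : nat)) => [|i /andP[ik nik]]; last first.
    have ik' : i < k.
      by rewrite ltn_neqAle ik andbT; apply: contraNneq nik => e; apply/eqP/val_inj.
    by rewrite /f ik'.
  move: s0; move: (\sum_(i < m.+1 | k < i) _) => x x0.
  by rewrite !addSn -addnS prednK.
have fd i : f i < d.+1.
  by rewrite ltnS -fsum (bigD1 i) //= leq_addr.
pose b : tup := [tuple Ordinal (fd i) | i < m.+1].
have bE i : tnth b i = f i :> nat by rewrite tnth_mktuple.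
have sb : \sum_(i < m.+1) tnth b i = d by rewrite -[RHS]fsum; apply: eq_bigr => i _; rewrite bE.
have ab : lexlt a b.
  apply/lexltP; exists (widen_ord (leqnSn m) k) => [i ik|].
    by apply/val_inj; rewrite /= bE /f ik.
  by rewrite bE /f ltnn eqxx.
have bg i : digits b i <= g i.
  rewrite /digits bE /f /=; case: ltnP => ki; first by rewrite -eg.
  case: eqP => [/val_inj->|_]; first exact: lt.
  by rewrite ltn_eqF.
exists b; last by split=> //; apply/negP => /(lexlt_trans ab); rewrite lexlt_irr.
apply/Omega'P; split=> // i /andP[i0 im] e.
have := bg (Ordinal im); rewrite /digits (_ : widen_ord _ _ = i) ?e; last exact/val_inj.
by rewrite leqNgt gd.
Qed.

End Exponents.

Section LowerBound.
Variables (K : closedFieldType) (d m r : nat).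
Hypotheses (d0 : (0 < d)%N) (m0 : (0 < m)%N) (mr : (m <= r <= 'C(d + m, m))%N).
Local Notation tup := (m.+1.-tuple 'I_d.+1).

Lemma rank_bound : (0 < r - (m - 1) <= #|Omega' d m|)%N.
Proof. by rewrite card_Omega' //; case/andP: mr; lia. Qed.

Let alpha := omega' (r - (m - 1)) d m.

Lemma alpha_Omega' : alpha \in Omega' d m.
Proof. by have [] := omega'P rank_bound. Qed.

Lemma H'E : H' (r - (m - 1)) d m = base_value d (digits alpha).
Proof. by []. Qed.

(** Of the ['C(d + m, m) - (m - 1)] elements of [Omega'], exactly [r - (m - 1)] are [alpha] or above
    it. What remains is the codimension of a system of rank [r]. *)
Lemma card_below_alpha : #|[set b in Omega' d m | lexlt b alpha]| = ('C(d + m, m) - r)%N.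
Proof.
have [_ e] := omega'P rank_bound; have := card_atleast alpha_Omega'.
have := cardsID [set b | lexlt b alpha] (Omega' d m).
rewrite card_Omega' // -setIdE (_ : _ :\: _ = [set b in Omega' d m | ~~ lexlt b alpha]); last first.
  by apply/setP => b; rewrite in_setD in_set [X in ~~ X]in_set andbC.
rewrite -/alpha in e; rewrite e; move: rank_bound; rewrite card_Omega' //.
move: (#|_|) (#|_|) => x y /andP[_]; case/andP: mr; lia.
Qed.

(** The [m - 1] members of [middle] make up for the shift of the rank and, together with [d e_1],
    force the zeros onto the grid. *)
Definition exponents : {set tup} := [set b in Omega' d m | ~~ lexlt b alpha] :|: middle d m.

Lemma sum_exponents b : b \in exponents -> (\sum_(i < m.+1) tnth b i)%N = d.
Proof.
rewrite in_setU in_set => /orP[/andP[/Omega'P[]//]|]; exact: sum_middle.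
Qed.

Lemma card_exponents : #|exponents| = r.
Proof.
rewrite cardsU card_atleast ?alpha_Omega' // card_middle //.
have [_ ->] := omega'P rank_bound; rewrite (_ : _ :&: _ = set0); last first.
  apply/setP => b; rewrite in_setI !in_set0 in_set.
  apply/negbTE/negP => /andP[/andP[bO _] bm]; move: bO; rewrite Omega'_compl in_setD.
  by rewrite bm.
rewrite cards0 subn0; have := rank_bound; case/andP: mr; lia.
Qed.

(** For [k = 0] the exponent [d e_1] is lexicographically maximal, hence not below [alpha]; the
    others are in [middle]. *)
Lemma pure_exponents (k : 'I_m) : pure d (widen_ord (leqnSn m) k) \in exponents.
Proof.
rewrite in_setU; have [k0|k0] := posnP k; last first.
  by apply/orP; right; apply/imsetP; exists (widen_ord (leqnSn m) k); rewrite // inE /= k0 /=.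
have kE : widen_ord (leqnSn m) k = ord0 by apply/val_inj.
apply/orP; left; rewrite kE in_set; apply/andP; split.
  apply/Omega'P; split=> [|i /andP[i0 _]]; first exact: sum_pure.
  rewrite pureE (gtn_eqF i0 : (i == ord0) = false) => e.
  by have := d0; rewrite -e.
apply/negP => /(lexlt_digits) H; have [sa _] := Omega'P _ alpha_Omega'.
have [j eb] := H (etrans (sum_pure d ord0) (esym sa)).
have p0 : digits (pure d (ord0 : 'I_m.+1)) k = d by rewrite /digits kE pureE.
have [->|j0] := eqVneq j k; first by rewrite p0 ltnNge digits_le.
have kj : (k < j)%N by rewrite k0 lt0n -k0; apply: contra j0 => /eqP/val_inj->.
have ak : digits alpha k = d by rewrite -eb // p0.
move=> lt; have : (digits alpha k + digits alpha j <= d)%N.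
  rewrite -[X in (_ <= X)%N]sa sum_digits (bigD1 k) //= (bigD1 j) //=; lia.
by rewrite ak; lia.
Qed.

Theorem lower_bound : finite_zero_count K d m r (H' (r - (m - 1)) d m).
Proof.
have [a a_inj] := distinct_elements K d.+1.
pose s := sort (fun b c : m.+1.-tuplelexi 'I_d.+1 => (b <= c)%O) (enum exponents).
have s_mem b : (b \in s) = (b \in exponents) by rewrite mem_sort mem_enum.
have s_sorted : sorted (@lexlt d m) s.
  have := @Order.TotalTheory.sort_lt_sorted _ (m.+1.-tuplelexi 'I_d.+1) (enum exponents).
  by rewrite enum_uniq; apply: id.
have sd (b : tup) : b \in s -> (\sum_(i < m.+1) tnth b i)%N = d.
  by rewrite s_mem; apply: sum_exponents.
pose W : {vspace hpoly K d m} := <<map (@grid_hpoly K d m a) s>>%VS.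
have WE w : (forall p : hpoly K d m, p \in W -> (val p).@[w] = 0) <->
    (forall b, b \in exponents -> (grid_form a b).@[w] = 0).
  split=> [H b bE|H].
    rewrite -(hprojE (grid_form_dhomog a (sum_exponents bE))); apply: H.
    by apply/memv_span/map_f; rewrite s_mem.
  suff sub : (W <= piece (vanish (fun _ : 'I_1 => w)) d)%VS.
    by move=> p /(subvP sub) /(pieceP (vanish_ideal _)); apply: (vanish_eval ord0).
  apply/span_subvP => _ /mapP[b bs ->]; apply/(pieceP (vanish_ideal _)).
  have fb := grid_form_dhomog a (sd b bs); rewrite hprojE //.
  by apply: (vanish_homog fb) => _; apply: H; rewrite -s_mem.
pose pt (g : {ffun 'I_m -> 'I_d}) : 'I_m.+1 -> K := grid_point a (fun k => g k).
have pt_nz g : nonzero (pt g) by exists ord_max; rewrite /pt /grid_point extend_max oner_neq0.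
have gd (g : {ffun 'I_m -> 'I_d}) k : (g k <= d)%N by apply: ltnW.
pose P g : proj_space K m :=
  exist (fun L : {vspace 'rV[K]_m.+1} => \dim L == 1%N) <[row_of (pt g)]>%VS (dim_row (pt_nz g)).
have P_inj : injective P.
  move=> g h /(congr1 val) /= e; apply/ffunP => k.
  have /vlineP[t et] : row_of (pt h) \in <[row_of (pt g)]>%VS by rewrite e memv_line.
  have t1 : t = 1.
    have /rowP/(_ ord_max) := et; rewrite !mxE /pt /grid_point !extend_max mulr1.
    by move->.
  have /rowP/(_ (widen_ord (leqnSn m) k)) := et.
  rewrite t1 scale1r !mxE /pt /grid_point !extend_widen.
  by move=> /a_inj eg; apply/val_inj; rewrite /= eg // ltnS ltnW.
pose G := [set g : {ffun 'I_m -> 'I_d} |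
  (base_value d (fun k => g k) < base_value d (digits alpha))%N].
exists W, [fset P g | g in G]%fset; split.
- rewrite -card_exponents cardE -(size_sort (fun b c : m.+1.-tuplelexi 'I_d.+1 => (b <= c)%O)).
  by rewrite -(size_map (@grid_hpoly K d m a)); apply/eqP; apply: grid_free.
- move=> Q; split.
    move/imfsetP => [g /= gG ->]; apply/(@zero_locusE _ _ _ _ _ (pt g)) => //; apply/WE => b bE.
    (* A form nonzero at the point of [g] has digits at most those of [g]. This puts the value of
       [b] below that of [alpha], which excludes [b >= alpha]; and a digit [d] excludes [middle]. *)
    apply/eqP/negP => /negP /(grid_form_neq0 a_inj b (gd g)) le.
    move: bE; rewrite in_setU => /orP[|/imsetP[i]].
      rewrite in_set => /andP[bO nb]; move: gG; rewrite inE ltnNge => /negP; apply.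
      apply: leq_trans (base_value_le d le); have [->//|ba] := eqVneq b alpha.
      by have := lexlt_total ba; rewrite (negbTE nb) => /(base_value_Omega' alpha_Omega' bO)/ltnW.
    rewrite inE => /andP[_ im] be; have := le (Ordinal im).
    by rewrite /digits be (_ : widen_ord _ _ = i) ?pureE ?eqxx 1?leqNgt ?ltn_ord //; apply/val_inj.
  rewrite (zero_locusE _ (val_coords Q)) WE => Qz.
  pose w := coords Q.
  (* The form of [d e_k] is the product of the [X_k - a_j X_m] over [j < d]. *)
  have wk (k : 'I_m) : exists j : 'I_d, w (widen_ord (leqnSn m) k) = a j * w ord_max.
    have := Qz _ (pure_exponents k); rewrite grid_form_eval pureE.
    rewrite (_ : (ord_max == _) = false) ?mulr1; last first.
      by rewrite -lift_max (negbTE (neq_lift _ _)).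
    move/eqP/prodf_eq0 => [k' _ /prodf_eq0[j _]]; rewrite subr_eq0 => /eqP wj.
    have dE : digits (pure d (widen_ord (leqnSn m) k)) k' = if k' == k then d else 0%N.
      by rewrite /digits pureE -!lift_max (inj_eq lift_inj).
    have := leq_trans (ltn_ord j) (eq_leq dE); case: eqP => // kk jd.
    exists (Ordinal jd); transitivity (w (widen_ord (leqnSn m) k')); last exact: wj.
    by rewrite kk.
  have [g0 gP] := fin_all_exists wk; pose g := [ffun k => g0 k].
  have wE i : w i = w ord_max * pt g i.
    rewrite /pt /grid_point; case: (unliftP ord_max i) => [k|] ->; last by rewrite extend_max mulr1.
    by rewrite lift_max extend_widen ffunE gP mulrC.
  have w0 : w ord_max != 0.
    by have [i] := coords_nonzero Q; apply: contraNneq => e; rewrite -/w wE e mul0r.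
  have QP : Q = P g.
    by apply/val_inj; rewrite val_coords /= -/w (row_of_scale w0 wE).
  rewrite QP; apply/imfsetP; exists g => //=; rewrite inE ltnNge; apply/negP => le.
  (* A grid point not below [alpha] is no zero: some form of the system is nonzero there. *)
  have [b bO [nb bg]] := exponent_below alpha_Omega' (fun k => ltn_ord (g k)) le.
  have bE : b \in exponents by rewrite in_setU in_set bO nb.
  have := Qz b bE; rewrite -/w.
  rewrite (_ : (grid_form a b).@[w] = w ord_max ^+ d * (grid_form a b).@[pt g]).
    apply/eqP; rewrite mulf_neq0 ?expf_neq0 //.
    exact/(grid_form_neq0 a_inj b (gd g)).
  rewrite -(meval_scale _ _ (grid_form_dhomog a (sum_exponents bE))).
  exact: meval_eq.
- rewrite card_imfset //= -cardE H'E card_base_value_lt //.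
  exact: base_value_Omega'_le alpha_Omega'.
Qed.

End LowerBound.

(** * The upper bounds *)

(** The family [v] lists representatives of the points of [V(W)] without repetition. *)
Definition zero_family (K : fieldType) d m (W : {vspace hpoly K d m}) N
    (v : 'I_N -> 'I_m.+1 -> K) : Prop :=
  [/\ family v, forall i (p : hpoly K d m), p \in W -> (val p).@[v i] = 0
    & forall w, nonzero w -> (forall p : hpoly K d m, p \in W -> (val p).@[w] = 0) ->
        exists i, ~ indep2 (v i) w].

Lemma finite_zero_family (K : fieldType) d m r k : finite_zero_count K d m r k ->
  exists (W : {vspace hpoly K d m}) (v : 'I_k -> 'I_m.+1 -> K),
    \dim W = r /\ zero_family W v.
Proof.
move=> [W [S [dW SP <-]]]; exists W.
pose P (i : 'I_(#|` S|)) := tnth (in_tuple (enum_fset S)) i.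
have PS i : P i \in S by apply: mem_tnth.
exists (fun i => coords (P i)); split=> //; split.
- split=> [i|i j ij]; first exact: coords_nonzero.
  apply: coords_indep; apply: contra ij => /eqP e; apply/eqP.
  by apply/(tuple_uniqP (in_tuple (enum_fset S))) => //; apply: fset_uniq.
- by move=> i; apply/(zero_locusE _ (val_coords (P i)))/SP.
move=> w nw wz.
pose Q : proj_space K m := exist (fun L : {vspace 'rV[K]_m.+1} => \dim L == 1%N) _ (dim_row nw).
have /SP : in_zero_locus W Q by apply/(@zero_locusE _ _ _ _ _ w).
move=> /(@tnthP _ _ (in_tuple (enum_fset S)))[i Qi]; exists i.
have : row_of (coords (P i)) \in <[row_of w]>%VS.
  by rewrite -[<[row_of w]>%VS]/(val Q) Qi val_coords memv_line.
case/vlineP => t /rowP e [a [b]]; rewrite /P.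
by have := e a; have := e b; rewrite !mxE => -> ->; rewrite mulrAC eqxx.
Qed.

Lemma zero_family_bezout (K : closedFieldType) d m (W : {vspace hpoly K d m}) N
    (v : 'I_N -> 'I_m.+1 -> K) :
  (0 < d)%N -> (0 < m)%N -> \dim W = m -> zero_family W v -> (N <= d ^ m)%N.
Proof.
move=> d0; case: m W v => [//|n] W v _ dW [fv Wv Wz]; have [nv _] := fv.
have [c cP] := avoid_hyperplane nv.
pose fs : seq {mpoly K[n.+2]} := [seq val p | p <- vbasis W].
have fsW f : f \in fs -> exists2 p : hpoly K d n.+1, p \in W & f = val p.
  by move=> /mapP[p pW ->]; exists p => //; apply: vbasis_mem.
apply: (@bezout K n d N fs c v) => //.
- by rewrite size_map size_tuple.
- by move=> f /fsW[p _ ->]; apply: dhomog_is_dhomog.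
- move=> w nw wz; have [p pW|i] := Wz w nw _; last exact: cP.
  rewrite (coord_vbasis pW) linear_sum /= (raddf_sum (meval w)) big1 // => i _.
  rewrite /= mevalZ wz ?mulr0 //; apply/map_f; by rewrite mem_nth // size_tuple.
- by move=> i f /fsW[p pW ->]; apply: Wv.
Qed.

Section UpperBound.
Variables (K : closedFieldType) (d m r : nat).
Hypotheses (d0 : (0 < d)%N) (m0 : (0 < m)%N) (mr : (m <= r <= 'C(d + m, m))%N).
Variables (W : {vspace hpoly K d m}) (N : nat) (v : 'I_N -> 'I_m.+1 -> K).
Hypotheses (dW : \dim W = r) (fW : zero_family W v).
Let alpha := omega' (r - (m - 1)) d m.

Lemma upper_bound_codim : ('C(d + m, m) - d <= r)%N -> (N <= base_value d (digits alpha))%N.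
Proof.
move=> rd; have [fv Wv _] := fW.
apply: leq_trans (card_below (alpha_Omega' d0 m0 mr)); rewrite card_below_alpha //.
have hv := hilb_vanish Wv; rewrite dW -bin_sub ?leq_addr // addKn in hv.
case: (leqP N d.+1) => Nd.
  apply: leq_trans hv; apply: (hilb_points (vanish_ideal v) fv) => // i p.
  exact: vanish_eval.
(* With more than [d.+1] points, the first [d.+1] would already impose more conditions than the
   codimension, which is at most [d]. *)
have fv' : family (fun i : 'I_d.+1 => v (widen_ord (ltnW Nd) i)).
  by case: fv => nv iv; split=> [i|i j ij]; [exact: nv | apply: iv].
have := hilb_points (vanish_ideal v) fv' (fun i p => @vanish_eval _ _ _ v p _) (leqnn _).
by lia.
Qed.

(** The rank in [Omega'] is now one, so nothing lies above [alpha], while [d e_1] is not below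
    it. *)
Lemma alpha_first : r = m -> alpha = pure d ord0.
Proof.
move=> rm; have aO := alpha_Omega' d0 m0 mr; have := omega'P (rank_bound d0 m0 mr).
rewrite -/alpha (_ : (r - (m - 1)).-1 = 0)%N; last by lia.
move=> [_ /eqP]; rewrite cards_eq0 => /eqP none.
have := pure_exponents d0 m0 mr (Ordinal m0).
rewrite (_ : widen_ord _ _ = ord0); last exact/val_inj.
rewrite in_setU => /orP[|/imsetP[i]]; last first.
  rewrite inE => /andP[i0 _] /(congr1 (fun b : m.+1.-tuple 'I_d.+1 => tnth b ord0 : nat)).
  rewrite !pureE eqxx; case: eqP => [e|_ e]; first by rewrite -e in i0.
  by exfalso; have := d0; rewrite e.
rewrite in_set -/alpha => /andP[pO np]; apply/eqP; apply/negP => /negP /lexlt_total.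
rewrite (negbTE np) orbF => ap.
by have := in_set0 (pure d (ord0 : 'I_m.+1)); rewrite -none in_set pO ap.
Qed.

Lemma base_value_pure0 : base_value d (digits (pure d (ord0 : 'I_m.+1))) = (d ^ m)%N.
Proof.
rewrite /base_value (bigD1 (Ordinal m0)) //= big1 => [|i ii].
  rewrite /digits pureE (_ : widen_ord _ _ = ord0) ?eqxx; last exact/val_inj.
  by rewrite addn0 -expnS subn1 prednK.
rewrite /digits pureE (_ : (_ == _) = false) //; apply/negbTE.
by apply: contra ii => /eqP/(congr1 val) /= e; apply/eqP/val_inj.
Qed.

Lemma upper_bound_bezout : r = m -> (N <= base_value d (digits alpha))%N.
Proof.
move=> rm; rewrite alpha_first // base_value_pure0.
by apply: (zero_family_bezout d0 m0 _ fW); rewrite dW.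
Qed.

End UpperBound.

Lemma upper_bound_plane (K : closedFieldType) d r (W : {vspace hpoly K d 2}) N
    (v : 'I_N -> 'I_3 -> K) :
  (0 < d)%N -> (2 <= r <= 'C(d + 2, 2))%N -> \dim W = r -> zero_family W v ->
  (N <= base_value d (digits (omega' (r - 1) d 2)))%N.
Proof.
move=> d0 mr dW [fv Wv Wz]; have aO := alpha_Omega' d0 (isT : 0 < 2)%N mr.
have := card_below_plane aO; rewrite card_below_alpha // base_value2 => ca.
apply: (plane_bound d0 fv Wv Wz).
- have [sa _] := Omega'P _ aO; rewrite -[X in (_ <= X)%N]sa sum_digits.
  rewrite big_ord_recr big_ord_recr big_ord0 /= add0n; apply: leq_trans (leq_addr _ _).
  by rewrite leq_add2r eq_leq //; congr (digits _ _); apply/val_inj.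
- by move=> _; apply: Omega'_digit_lt.
by rewrite dW -bin_sub ?leq_addr // addKn.
Qed.

Local Close Scope ring_scope.

Theorem theorem1p8 (K : closedFieldType) (d m r : nat)
    (hd : 0 < d) (hm : 0 < m) (hr : 0 < r)
    (hmr : m <= r <= 'C(d + m, m))
    (hcase : d = 1 \/ m = 1 \/ m = 2 \/ r = m \/
             'C(m + d, d) - d <= r <= 'C(m + d, d)) :
  u_is K r d m (H' (r - (m - 1)) d m).
Proof.
split; first exact: lower_bound.
move=> k /finite_zero_family[W [v [dW fW]]]; rewrite H'E.
have codim : ('C(d + m, m) - d <= r)%N -> (k <= base_value d (digits (omega' (r - (m - 1)) d m)))%N.
  by move=> le; apply: (upper_bound_codim hd hm hmr dW fW).
case: hcase => [d1|[m1|[m2|[rm|/andP[le _]]]]].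
(* For [d = 1] the threshold ['C(d + m, m) - d] is [m], and for [m = 1] it is [1]; both are at most
   [r]. *)
- by apply: codim; rewrite d1 add1n binSn; case/andP: hmr; lia.
- by apply: codim; rewrite m1 addn1 bin1; lia.
- by subst m; apply: upper_bound_plane fW.
- exact: (upper_bound_bezout hd hm hmr dW fW).
by apply: codim; rewrite -bin_sub ?leq_addl // addnK addnC.
Qed.
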